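(* Let $d\ge 2$, let $\Phi$ be a homogeneous Poisson point process with intensity $\lambda>0$ on $\mathbb{R}^d$, and let $R_o$ be the distance from the nucleus to a uniformly random point in the typical cell $V_o$. Then the cumulative distribution function of $R_o$ is $$F_{R_o}(z)=\lim_{\ell\to\infty}\sum_{k=0}^\infty F_{R_\ell}(z;k)\,\mathbb{P}\big(\Phi(\mathcal{B}_{2\ell}(o))=k\big),\qquad z\ge 0,$$ where, for $0\le z\le\ell$, $$F_{R_\ell}(z;k)=\int_{(\tilde{\mathbb{D}}^d)^k}\frac{g_k(z;(u_1,\boldsymbol{\alpha}_1),\dots,(u_k,\boldsymbol{\alpha}_k))}{g_k(\ell;(u_1,\boldsymbol{\alpha}_1),\dots,(u_k,\boldsymbol{\alpha}_k))}\prod_{i=1}^k\frac{1}{\kappa_d\ell^d}u_i^{d-1}\Delta(\boldsymbol{\alpha}_i)\,{\rm d}u_i\,{\rm d}\boldsymbol{\alpha}_i ,$$ with $g_k$, $\Delta$ and $\tilde{\mathbb{D}}^d$ as defined in the context.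
   Context: Typical cell: $V_o=\{\mathbf{y}\in\mathbb{R}^d : \|\mathbf{y}\|\le\|\mathbf{x}-\mathbf{y}\|\ \ \forall\mathbf{x}\in\Phi\}$, with nucleus the origin $o$. Conditionally on $\Phi$, let $\mathbf{Y}$ be uniform on $V_o$; then $R_o=\|\mathbf{Y}\|$. $\mathcal{B}_r(o)$ is the ball of radius $r$ centered at $o$, $\Phi(A)$ is the number of points of $\Phi$ in $A$ (so $\Phi(\mathcal{B}_{2\ell}(o))$ is Poisson with mean $\lambda\kappa_d(2\ell)^d$), and $\kappa_d=\pi^{d/2}/\Gamma(\frac d2+1)$ is the volume of the unit ball. Polar coordinates: for $r\ge0$ and $\boldsymbol{\alpha}=(\alpha_1,\dots,\alpha_{d-1})$ with $\alpha_1,\dots,\alpha_{d-2}\in[0,\pi]$ and $\alpha_{d-1}\in[0,2\pi)$, $(r,\boldsymbol{\alpha})$ denotes the point $\mathbf{y}\in\mathbb{R}^d$ with Cartesian coordinates $y_1=r\cos\alpha_1$, $y_n=r\big(\prod_{j=1}^{n-1}\sin\alpha_j\big)\cos\alpha_n$ for $1<n<d$, and $y_d=r\prod_{j=1}^{d-1}\sin\alpha_j$. Put $\Delta(\boldsymbol{\alpha})=\sin^{d-2}(\alpha_1)\sin^{d-3}(\alpha_2)\cdots\sin(\alpha_{d-2})$ (equal to $1$ if $d=2$), $\mathbb{D}=[0,\pi]^{d-2}\times[0,2\pi)$ and $\tilde{\mathbb{D}}^d=[0,\ell]\times\mathbb{D}$. For points $(l_1,\boldsymbol{\theta}_1),\dots,(l_k,\boldsymbol{\theta}_k)\in\tilde{\mathbb{D}}^d$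 (representing the halved points $\frac12\mathbf{x}_i$, $\mathbf{x}_i\in\Phi\cap\mathcal{B}_{2\ell}(o)$) and $\mathbf{y}=(r,\boldsymbol{\alpha})$, let $D_i(l_i,\boldsymbol{\theta}_i,\mathbf{y})=\mathbf{1}\big(d_2(\mathbf{y},(2l_i,\boldsymbol{\theta}_i))>r\big)$ if $l_i\le r$, and $D_i(l_i,\boldsymbol{\theta}_i,\mathbf{y})=1$ if $l_i>r$, where $d_2$ is the Euclidean distance between the points with the indicated polar coordinates. Define, for $0\le z\le \ell$, $$g_k(z;(l_1,\boldsymbol{\theta}_1),\dots,(l_k,\boldsymbol{\theta}_k))=\int_{\mathbb{D}}\int_0^z\prod_{i=1}^kD_i(l_i,\boldsymbol{\theta}_i,(r,\boldsymbol{\alpha}))\,r^{d-1}\Delta(\boldsymbol{\alpha})\,{\rm d}r\,{\rm d}\boldsymbol{\alpha}.$$ For $k=0$ products are empty (equal to 1) and $F_{R_\ell}(z;0)=g_0(z)/g_0(\ell)$. *)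

(* Defs.v *)
From HB Require Import structures.
From mathcomp Require Import all_boot all_order all_algebra.
From mathcomp Require Import all_classical all_reals all_analysis.
From mathcomp Require Import measurable_realfun.
Import Order.TTheory GRing.Theory Num.Theory.
Import numFieldNormedType.Exports.

Set Implicit Arguments.
Unset Strict Implicit.
Unset Printing Implicit Defensive.

Local Open Scope classical_set_scope.
Local Open Scope ring_scope.

(* The product of two sigma-finite measures, as a sigma-finite measure: the
   library infers that structure on _ \x _ only for (sub)probabilities. *)
Section prod_measure.
Context (d1 d2 : measure_display) (T1 : measurableType d1)
  (T2 : measurableType d2) (R : realType).
Variable m1 : {sigma_finite_measure set T1 -> \bar R}.
Variable m2 : {sigma_finite_measure set T2 -> \bar R}.

Definition prod_measure : set (T1 * T2) -> \bar R := (m1 \x m2)%E.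

HB.instance Definition _ := Measure.copy prod_measure (m1 \x m2)%E.

Let prod_measure_sigma_finite : sigma_finite setT prod_measure.
Proof.
have /sigma_finiteP[F [TF ndF Foo]] := sigma_finiteT m1.
have /sigma_finiteP[G [TG ndG Goo]] := sigma_finiteT m2.
exists (fun n => F n `*` G n).
  rewrite -setXTT TF TG predeqE => -[x y]; split.
    move=> [/= [n _ Fnx] [k _ Gky]]; exists (maxn n k) => //; split.
    - by move: x Fnx; exact/subsetPset/ndF/leq_maxl.
    - by move: y Gky; exact/subsetPset/ndG/leq_maxr.
  by move=> [n _ []/= ? ?]; split; exists n.
move=> k; have [? ?] := Foo k; have [? ?] := Goo k.
split; first exact: measurableX.
by rewrite /prod_measure product_measure1E// lte_mul_pinfty// ge0_fin_numE.
Qed.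

HB.instance Definition _ := Measure_isSigmaFinite.Build _ _ _ prod_measure
  prod_measure_sigma_finite.

End prod_measure.

Section cons_measure.
Context (d : measure_display) (T : measurableType d) (R : realType) (n : nat).
Variable m : {sigma_finite_measure set T -> \bar R}.
Variable mn : {sigma_finite_measure set (n.-tuple T) -> \bar R}.

Definition tuple_cons (p : T * n.-tuple T) : n.+1.-tuple T :=
  [tuple of p.1 :: p.2].

Definition tuple_uncons (t : n.+1.-tuple T) : T * n.-tuple T :=
  (thead t, [tuple of behead t]).

Lemma measurable_tuple_cons : measurable_fun setT tuple_cons.
Proof. exact: measurable_cons measurable_fst measurable_snd. Qed.

Lemma measurable_tuple_uncons : measurable_fun setT tuple_uncons.
Proof.
apply/measurable_fun_pairP; split.
- exact: (measurable_tnth (T := T) ord0).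
- exact: measurable_behead.
Qed.

Lemma tuple_consK : cancel tuple_cons tuple_uncons.
Proof. by case=> x t; congr (_, _); apply/val_inj. Qed.

Lemma tuple_unconsK : cancel tuple_uncons tuple_cons.
Proof. by move=> t; rewrite [RHS]tuple_eta; apply/val_inj => /=. Qed.

Definition cons_measure : set (n.+1.-tuple T) -> \bar R :=
  pushforward (prod_measure m mn) tuple_cons.

Let cons_measure0 : cons_measure set0 = 0%E.
Proof. by rewrite /cons_measure /pushforward preimage_set0 measure0. Qed.

Let cons_measure_ge0 A : (0 <= cons_measure A)%E.
Proof. exact: (measure_ge0 (prod_measure m mn)). Qed.

Let cons_measure_sigma_additive : semi_sigma_additive cons_measure.
Proof.
move=> F mF tF mUF.
have mc A : measurable A -> measurable (tuple_cons @^-1` A).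
  by move=> mA; rewrite -[X in measurable X]setTI;
    exact: measurable_tuple_cons.
rewrite /cons_measure /pushforward preimage_bigcup.
apply: measure_semi_sigma_additive => [i||]; first exact: mc.
- apply/trivIsetP => /= i j _ _ ij; rewrite -preimage_setI.
  by move/trivIsetP : tF => /(_ _ _ _ _ ij) ->//; rewrite preimage_set0.
- by rewrite -preimage_bigcup; exact: mc.
Qed.

HB.instance Definition _ := isMeasure.Build _ _ _ cons_measure
  cons_measure0 cons_measure_ge0 cons_measure_sigma_additive.

Let cons_measure_sigma_finite : sigma_finite setT cons_measure.
Proof.
have [H TH Hoo] := sigma_finiteT (prod_measure m mn).
exists (fun k => tuple_uncons @^-1` H k).
  by rewrite -preimage_bigcup -TH preimage_setT.
move=> k; have [mH Hk] := Hoo k; split.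
  by rewrite -[X in measurable X]setTI; exact: measurable_tuple_uncons.
rewrite /cons_measure /pushforward -comp_preimage.
by rewrite (_ : _ \o _ = id) ?preimage_id//; apply/funext => p; exact: tuple_consK.
Qed.

HB.instance Definition _ := Measure_isSigmaFinite.Build _ _ _ cons_measure
  cons_measure_sigma_finite.

End cons_measure.

(* n-fold product of m with itself; for n = 0 the unit mass at the empty
   tuple. *)
Fixpoint tuple_measure (d : measure_display) (T : measurableType d)
    (R : realType) (m : {sigma_finite_measure set T -> \bar R}) (n : nat) :
    {sigma_finite_measure set (n.-tuple T) -> \bar R} :=
  match n with
  | 0 => dirac [tuple]
  | k.+1 => cons_measure m (tuple_measure m k)
  end.

(* The coordinates are in measurableTypeR R, which is R with its Borel sets,
   the type on which lebesgue_measure is defined. *)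
Notation euclidean R d := (d.-tuple (measurableTypeR R)).

Section euclidean_space.
Context {R : realType}.

Definition lebesgue (d : nat) :
    {sigma_finite_measure set (euclidean R d) -> \bar R} :=
  tuple_measure (@lebesgue_measure R) d.

Definition edist d (x y : euclidean R d) : R :=
  Num.sqrt (\sum_(i < d) ((tnth x i : R) - (tnth y i : R)) ^+ 2).

Definition enorm d (x : euclidean R d) : R :=
  Num.sqrt (\sum_(i < d) (tnth x i : R) ^+ 2).

Definition eball d (r : R) : set (euclidean R d) := [set x | enorm x <= r].

Lemma measurable_enorm d : measurable_fun setT (@enorm d).
Proof.
apply: measurableT_comp.
  by apply: nondecreasing_measurable => // x y; exact: ler_wsqrtr.
apply: measurable_sum => i; apply: measurable_funX.
exact: (measurable_tnth (T := measurableTypeR R) i).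
Qed.

HB.instance Definition _ d :=
  isMeasurableFun.Build _ _ _ _ (@enorm d) (@measurable_enorm d).

End euclidean_space.
Arguments eball {R} d r.

Section point_process.
Context {R : realType} {dO : measure_display} {Omega : measurableType dO}.
Context {d : nat}.
Implicit Types (P : probability Omega R) (Phi : Omega -> set (euclidean R d)).

Definition npoints Phi (A : set (euclidean R d)) (w : Omega) : \bar R :=
  counting (Phi w `&` A).

Definition npoints_eq Phi A (k : nat) : set Omega :=
  [set w | npoints Phi A w = k%:R%:E].

(* A (simple) point process is a random locally finite set of points. The
   Poisson law is written with poisson_prob rather than poisson_pmf because the
   latter is 1 at rate 0, whereas the former is then the unit mass at 0; the
   argument 0%N of poisson_prob is a dummy. *)
Record poisson_process P (lambda : R) Phi : Prop := PoissonProcess {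
  pp_locally_finite : forall w r, finite_set (Phi w `&` eball d r) ;
  pp_measurable : forall A, measurable A ->
    measurable_fun setT (npoints Phi A) ;
  pp_poisson : forall A k, measurable A -> (lebesgue d A < +oo)%E ->
    P (npoints_eq Phi A k) =
    poisson_prob (lambda * fine (lebesgue d A)) 0%N [set k] ;
  pp_independent : forall n (A : 'I_n -> set (euclidean R d)) (k : 'I_n -> nat),
    (forall i, measurable (A i)) -> trivIset setT A ->
    P (\bigcap_i npoints_eq Phi (A i) (k i)) =
    (\prod_(i < n) P (npoints_eq Phi (A i) (k i)))%E }.

Definition sigma_process Phi : set (set Omega) :=
  <<s \bigcup_(A in measurable)
        preimage_set_system setT (npoints Phi A) measurable >>.

(* The nucleus is the origin, which is not itself listed in X. *)
Definition typical_cell (X : set (euclidean R d)) : set (euclidean R d) :=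
  [set y | forall x, X x -> enorm y <= edist x y].

(* In \bar R, x / +oo = 0; this affects only the null event that the typical
   cell has infinite volume. *)
Definition uniform_law (V B : set (euclidean R d)) : \bar R :=
  (lebesgue d (B `&` V) / lebesgue d V)%E.

(* uniform_law (typical_cell (Phi w)) is a version of the conditional law of Y
   given (the sigma-algebra generated by) Phi. *)
Definition cond_uniform_on_cell P Phi (Y : Omega -> euclidean R d) : Prop :=
  forall (E : set Omega) (B : set (euclidean R d)),
    sigma_process Phi E -> measurable B ->
    P (E `&` Y @^-1` B) =
    (\int[P]_(w in E) uniform_law (typical_cell (Phi w)) B)%E.

Definition distance_to_nucleus P (Y : {RV P >-> euclidean R d}) : {RV P >-> R} :=
  (@enorm R d) \o Y.

End point_process.

Section polar.
Context {R : realType}.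

Definition Gamma (x : R) : R :=
  \int[lebesgue_measure]_(t in `]0, +oo[) (t `^ (x - 1) * expR (- t)).

Definition kappa (d : nat) : R :=
  pi `^ (d%:R / 2) / Gamma (d%:R / 2 + 1).

Variable d : nat.
Local Notation angles := (euclidean R d.-1).
Local Notation polar_coord := (measurableTypeR R * angles)%type.
Implicit Types (r l z : R) (a th : angles).

(* Angles are numbered from 0, so that a`_j is alpha_(j+1). *)
Definition polar_point r a : euclidean R d :=
  [tuple r * (\prod_(j < i) sin (a`_j : R)) *
     (if (i < d.-1)%N then cos (a`_i : R) else 1) | i < d].

Definition Delta a : R :=
  \prod_(j < d.-2) sin (a`_j : R) ^+ (d - 2 - j).

Definition angle_domain : set angles :=
  [set a | forall j : 'I_d.-1,
     if (j < d.-2)%N then 0 <= (tnth a j : R) <= pi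
     else 0 <= (tnth a j : R) < 2 * pi].

Definition polar_domain l : set polar_coord :=
  `[0, l]%classic `*` angle_domain.

Definition polar_measure : {sigma_finite_measure set polar_coord -> \bar R} :=
  prod_measure (@lebesgue_measure R) (lebesgue d.-1).

(* u stands for the halved point x / 2, so x itself has radius 2 * u.1. *)
Definition Dind (u : polar_coord) r a : R :=
  if u.1 <= r
  then (r < edist (polar_point r a) (polar_point (2 * u.1) u.2))%R%:R
  else 1.

Definition g_k (k : nat) z (us : k.-tuple polar_coord) : R :=
  \int[lebesgue d.-1]_(a in angle_domain)
    \int[lebesgue_measure]_(r in `[0, z])
      ((\prod_(i < k) Dind (tnth us i) r a) * r ^+ d.-1 * Delta a).

Definition F_Rl l z (k : nat) : R :=
  \int[tuple_measure polar_measure k]_(us in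
      [set us | forall i, polar_domain l (tnth us i)])
    (g_k z us / g_k l us *
     \prod_(i < k) ((kappa d * l ^+ d)^-1 *
       ((tnth us i).1 : R) ^+ d.-1 * Delta (tnth us i).2)).

End polar.

(* Main.v *)
From HB Require Import structures.
From mathcomp Require Import all_boot all_order all_algebra.
From mathcomp Require Import all_classical all_reals all_analysis.
From mathcomp Require Import measurable_realfun lra ring.
Require Import Defs.
Import Order.TTheory GRing.Theory Num.Theory.
Import numFieldNormedType.Exports.

Set Implicit Arguments.
Unset Strict Implicit.
Unset Printing Implicit Defensive.

Local Open Scope classical_set_scope.
Local Open Scope ring_scope.

(** Write V(X) for the cell of the origin in a configuration X of nuclei, and
    for 0 <= z <= l let f_l(X) be the volume of the part of V(X) in the ball
    B_z divided by the volume of its part in the ball B_l.  The theorem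
    identifies each side with an expectation of such a ratio.

    Left-hand side.  A nucleus x with |x| > 2 l is farther than |y| from every
    y in B_l, so f_l only sees the nuclei in B_(2l).  There the process is a
    Poisson mixture of independent uniform points [ball_config_law]: by Rényi's
    theorem [eq_void_probability] it suffices to compare the probabilities that
    a set contains no point, and these are exponential series.  The k-th
    integral in the statement is the expectation of f_l for k independent
    uniform points, written in the polar coordinates of the halved points
    [F_Rl_conditional_law].  Hence the series is the expectation of
    f_l(Phi) [mixture_expectation].

    Right-hand side.  Given Phi the point Y is uniform on V(Phi), so the
    distribution function is the expectation of the volume of V(Phi) in B_z
    divided by the volume of V(Phi) [cdf_distance_to_nucleus].

    As l tends to infinity the volume of V(Phi) in B_l increases to that of
    V(Phi), which is positive because Phi is locally finite; so f_l(Phi)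
    converges to this quotient [cvg_cell_ratio].  As f_l <= 1, dominated
    convergence concludes.

    Three facts of integration theory support the translation into the
    formulas of the statement: integration in polar coordinates in every
    dimension [integral_polar], the volume kappa_d r^d of balls
    [lebesgue_eball], and the measurability of the volume of a part of the
    cell as a function of the configuration [measurable_cell_volume].  The
    functions g_k use strict inequalities where the cell uses weak ones; on
    each ray from the origin the two differ at one radius per nucleus, so
    g_k is a volume of a part of the cell [g_k_volume]. *)

(** * Densities, image measures and integration over tuples *)

Section weighted_pushforward.
Local Open Scope ereal_scope.
Context d1 d2 (T1 : measurableType d1) (T2 : measurableType d2) (R : realType).
Variables (m : {measure set T1 -> \bar R}) (phi : T1 -> T2) (w : T1 -> R).
Hypotheses (mphi : measurable_fun setT phi) (mw : measurable_fun setT w).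
Hypothesis w0 : forall x, (0 <= w x)%R.

(** The image under phi of the measure with density w.  The proofs are arguments
    so that the structure of a measure can be inferred from the term. *)
Definition weighted_pushforward of measurable_fun setT phi & measurable_fun setT w
  & (forall x, (0 <= w x)%R) : set T2 -> \bar R :=
  fun A => \int[m]_(x in phi @^-1` A) (w x)%:E.

Local Notation mu := (weighted_pushforward mphi mw w0).

Let mpre A : measurable A -> measurable (phi @^-1` A).
Proof. by move=> mA; rewrite -[X in measurable X]setTI; exact: mphi. Qed.

Let mu0 : mu set0 = 0.
Proof. by rewrite /weighted_pushforward preimage_set0 integral_set0. Qed.

Let mu_ge0 A : 0 <= mu A.
Proof. by apply: integral_ge0 => x _; rewrite lee_fin. Qed.

Let mu_sigma_additive : semi_sigma_additive mu.
Proof.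
move=> F mF tF mUF; rewrite /weighted_pushforward; apply: cvg_toP.
  apply: ereal_nondecreasing_is_cvgn => a b ab.
  apply: lee_sum_nneg_natr => // k _ _; apply: integral_ge0 => /= x _.
  by rewrite lee_fin.
rewrite preimage_bigcup ge0_integral_bigcup//=.
- by move=> k; exact: mpre.
- exact/measurable_EFinP/measurable_funTS.
- by move=> x _; rewrite lee_fin.
- apply/trivIsetP => i j _ _ ij; rewrite -preimage_setI.
  by move/trivIsetP : tF => /(_ _ _ _ _ ij) ->//; rewrite preimage_set0.
Qed.

HB.instance Definition _ :=
  isMeasure.Build _ _ _ mu mu0 mu_ge0 mu_sigma_additive.

Import HBNNSimple.

(** The standard machine: both sides are linear and continuous along increasing
    sequences, and they agree on indicators by definition of the measure. *)
Lemma integral_weighted_pushforward (f : T2 -> \bar R) : measurable_fun setT f ->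
  (forall y, 0 <= f y) ->
  \int[mu]_y f y = \int[m]_x (f (phi x) * (w x)%:E).
Proof.
move=> mf f0; pose h := nnsfun_approx measurableT mf.
have cvgh y : EFin \o h^~ y @ \oo --> f y by exact: cvg_nnsfun_approx.
have ndh y : nondecreasing_seq (h^~ y).
  by move=> a b ab; exact/lefP/nd_nnsfun_approx.
have mhr n r : measurable (h n @^-1` [set r]).
  by rewrite -[X in measurable X]setTI; exact: measurable_funP.
have mi n r : measurable_fun setT (fun x => \1_(h n @^-1` [set r]) (phi x) : R).
  have := @measurable_indic _ T2 R setT _ (mhr n r).
  by move=> /measurableT_comp /(_ mphi).
transitivity (limn (fun n => \int[mu]_y (h n y)%:E)).
  rewrite -monotone_convergence//.
  - by apply: eq_integral => y _; apply/esym/cvg_lim => //; exact: cvgh.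
  - by move=> n; exact/measurable_EFinP.
  - by move=> n x _; rewrite lee_fin.
  - by move=> y _ a b ab; rewrite lee_fin; exact: ndh.
transitivity (limn (fun n => \int[m]_x ((h n (phi x))%:E * (w x)%:E))); last first.
  rewrite -monotone_convergence//.
  - apply: eq_integral => x _; apply/cvg_lim => //; apply: cvgeZr => //.
    exact: cvgh.
  - move=> n; apply: emeasurable_funM; last exact/measurable_EFinP.
    exact/measurable_EFinP/measurableT_comp.
  - by move=> n x _; rewrite mule_ge0 ?lee_fin.
  - by move=> x _ a b ab; rewrite lee_wpmul2r ?lee_fin//; exact: ndh.
apply/congr_lim/funext => n.
transitivity (\int[mu]_y
    (\sum_(r \in range (h n)) (r * \1_(h n @^-1` [set r]) y)%:E)).
  by apply: eq_integral => y _; rewrite fimfunE -fsumEFin.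
transitivity (\int[m]_x (\sum_(r \in range (h n))
    (r * \1_(h n @^-1` [set r]) (phi x))%:E * (w x)%:E)); last first.
  apply: eq_integral => x _; rewrite -ge0_mule_fsuml//; last first.
    by move=> r; exact: nnfun_muleindic_ge0.
  by rewrite fsumEFin// -(fimfunE _ (phi x)).
rewrite ge0_integral_fsum//; last 2 first.
  - by move=> r; apply/measurable_EFinP; exact: measurable_funM.
  - by move=> r y _; exact: nnfun_muleindic_ge0.
rewrite ge0_integral_fsum//; last 2 first.
  - move=> r; apply: emeasurable_funM; last exact/measurable_EFinP.
    apply/measurable_EFinP; exact: measurable_funM.
  - by move=> r x _; rewrite mule_ge0 ?lee_fin//; exact: nnfun_muleindic_ge0.
apply: eq_fsbigr => r /set_mem[y0 _ hy0].
have r0 : (0 <= r)%R by rewrite -hy0.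
rewrite integralZl_indic_nnsfun// integral_indic// setIT.
under [RHS]eq_integral do rewrite EFinM -muleA.
rewrite ge0_integralZl//; last 2 first.
  - apply: emeasurable_funM; last exact/measurable_EFinP.
    apply/measurable_EFinP.
    exact: mi.
  - by move=> x _; rewrite mule_ge0 ?lee_fin.
congr (_ * _); rewrite [LHS](integral_mkcond (phi @^-1` _)).
apply: eq_integral => x _.
rewrite patchE indicE [X in if X then _ else _](_ : _ = (phi x \in h n @^-1` [set r])).
  by case: ifPn => _; rewrite ?mul1e ?mul0e.
by apply/idP/idP; rewrite !inE.
Qed.

End weighted_pushforward.

Section tonelli_tuple.
Local Open Scope ereal_scope.
Context (d : measure_display) (T : measurableType d) (R : realType).

Section cons.
Context (n : nat) (m : {sigma_finite_measure set T -> \bar R}).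
Variable mn : {sigma_finite_measure set (n.-tuple T) -> \bar R}.
Variable f : n.+1.-tuple T -> \bar R.
Hypotheses (mf : measurable_fun setT f) (f0 : forall x, 0 <= f x).

Let mfc : measurable_fun setT (f \o @tuple_cons d T n).
Proof. exact: measurableT_comp mf (@measurable_tuple_cons _ _ _). Qed.

Lemma integral_cons_prod :
  \int[cons_measure m mn]_t f t =
  \int[prod_measure m mn]_p f (tuple_cons p).
Proof.
rewrite (@ge0_integral_pushforward _ _ _ _ _ _ (@measurable_tuple_cons _ _ _)
  (prod_measure m mn))//.
Qed.

Lemma integral_cons : \int[cons_measure m mn]_t f t =
  \int[m]_x \int[mn]_s f (tuple_cons (x, s)).
Proof.
rewrite integral_cons_prod.
exact: (fubini_tonelli1 (m1 := m) (m2 := mn) _ mfc (fun p => f0 _)).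
Qed.

Lemma integral_cons_swap : \int[cons_measure m mn]_t f t =
  \int[mn]_s \int[m]_x f (tuple_cons (x, s)).
Proof.
rewrite integral_cons_prod.
exact: (fubini_tonelli2 (m1 := m) (m2 := mn) _ mfc (fun p => f0 _)).
Qed.

End cons.

Lemma integral_tuple_prod (m : {sigma_finite_measure set T -> \bar R})
    (h : T -> R) n : measurable_fun setT h -> (forall x, (0 <= h x)%R) ->
  \int[tuple_measure m n]_t (\prod_(i < n) h (tnth t i))%:E =
  (\int[m]_x (h x)%:E) ^+ n.
Proof.
move=> mh h0.
have mprod k : measurable_fun setT
    (fun t : k.-tuple T => (\prod_(i < k) h (tnth t i))%:E).
  apply/measurable_EFinP; apply: measurable_prod => i _.
  by apply: measurableT_comp => //; exact: measurable_tnth.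
elim: n => [|n IH].
  rewrite /= integral_dirac//; first by rewrite diracT mul1e big_ord0.
  exact: mprod.
rewrite [LHS](integral_cons m (tuple_measure m n) (mprod n.+1)); last first.
  by move=> t; rewrite lee_fin; apply: prodr_ge0.
rewrite expeS -IH.
transitivity (\int[m]_x ((h x)%:E *
    \int[tuple_measure m n]_s (\prod_(i < n) h (tnth s i))%:E)).
  apply: eq_integral => x _; rewrite -ge0_integralZl//.
  - apply: eq_integral => s _; rewrite big_ord_recl EFinM; congr (_ * _%:E).
    by apply: eq_bigr => i _; rewrite tnthS.
  - exact: mprod.
  - by move=> s _; rewrite lee_fin; apply: prodr_ge0.
  - by rewrite lee_fin.
rewrite ge0_integralZr//.
- exact/measurable_EFinP.
- by move=> x _; rewrite lee_fin.
- by apply: integral_ge0 => s _; rewrite lee_fin; apply: prodr_ge0.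
Qed.

End tonelli_tuple.

(** * Substitution in one-dimensional integrals *)

Section substitution.
Context {R : realType}.
Local Notation mu := (@lebesgue_measure R).
Local Notation mR := (measurableTypeR R).
Implicit Types (phi : mR -> mR) (w : mR -> R) (f : mR -> \bar R).

(** The inverse is continuous off 0 and vanishes at 0, so it is equal to its own
    restriction to an open set on which it is continuous. *)
Lemma measurable_invr : measurable_fun setT (@GRing.inv R).
Proof.
have cinv : {in [set x : R | x != 0], continuous (@GRing.inv R)}.
  by move=> x; rewrite inE/= => x0; exact: inv_continuous.
have oD : open [set x : R | x != 0].
  exact: open_neq.
have mD : measurable [set x : R | x != 0] by exact: open_measurable.
rewrite (_ : @GRing.inv R = (@GRing.inv R) \_ [set x : R | x != 0]); last first.
  apply/funext => x; rewrite patchE; case: ifPn => //.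
  by rewrite notin_setE/= => /negP; rewrite negbK => /eqP ->; rewrite invr0.
apply/(measurable_restrictT _ mD).
exact: open_continuous_measurable_fun.
Qed.

(** A weighted map that sends Lebesgue measure to Lebesgue measure on intervals
    does so on all Borel sets, hence is a valid substitution for every
    nonnegative integrand. *)
Lemma lebesgue_substitution phi w : measurable_fun setT phi -> measurable_fun setT w ->
  (forall x, 0 <= w x) ->
  (forall a b : R, a < b ->
    (\int[mu]_(x in phi @^-1` `]a, b]) (w x)%:E = (b - a)%:E)%E) ->
  forall f, measurable_fun setT f -> (forall x, 0 <= f x)%E ->
  (\int[mu]_x f x = \int[mu]_x (f (phi x) * (w x)%:E))%E.
Proof.
move=> mphi mw w0 H f mf f0; rewrite -(integral_weighted_pushforward mu mphi mw w0)//.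
apply: eq_measure_integral.
move=> A mA _; apply: (@lebesgue_measure_unique R (weighted_pushforward mu mphi mw w0)) => //.
move=> _ [[a b] _ <-] /=; have [ab|ba] := ltP a b.
  by rewrite [RHS]H//= lebesgue_measure_itv/= lte_fin ab EFinB.
by rewrite set_itv_ge ?measure0// bnd_simp -leNgt.
Qed.

Lemma integral_affine (c b : R) f : c != 0 -> measurable_fun setT f ->
  (forall x, 0 <= f x)%E ->
  (\int[mu]_x f x = \int[mu]_x (f (c * (x : R) + b)%R * `|c|%:E))%E.
Proof.
move=> c0; apply: (@lebesgue_substitution (fun x : R => c * x + b) (cst `|c|)) => //.
- by apply: measurable_funD => //; exact: measurable_funM.
move=> u v uv.
have mD : measurable ((fun x : mR => (c * (x : R) + b)%R : mR) @^-1` `]u, v]).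
  rewrite -[X in measurable X]setTI.
  by apply: measurable_funD => //; exact: measurable_funM.
rewrite [LHS](integral_cst mu mD `|c|%:E) [X in (_ * X)%E]/=.
have [c0'|c0'] := ltP 0 c.
  rewrite (_ : _ @^-1` _ = `](u - b) / c, (v - b) / c]%classic).
    rewrite lebesgue_measure_itv/= lte_fin ltr_pM2r ?invr_gt0// ltrD2r uv.
    rewrite -EFinB -EFinM gtr0_norm//; congr EFin.
    by field.
  apply/seteqP; split => x /=; rewrite !in_itv/= ltr_pdivrMr// ler_pdivlMr//;
    by rewrite ltrBlDr lerBrDr mulrC.
have {c0 c0'}c0 : c < 0 by rewrite lt_neqAle c0.
rewrite (_ : _ @^-1` _ = `[(v - b) / c, (u - b) / c[%classic).
  rewrite lebesgue_measure_itv/= lte_fin ltr_nM2r ?invr_lt0// ltrD2r uv.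
  rewrite -EFinB -EFinM ltr0_norm//; congr EFin.
  by field; rewrite lt_eqF.
apply/seteqP; split => x /=; rewrite !in_itv/= ler_ndivrMr// ltr_ndivlMr//;
  by rewrite ltrBlDr lerBrDr mulrC andbC.
Qed.

Lemma measurable_sin : measurable_fun setT (@sin R : mR -> R).
Proof. by apply: continuous_measurable_fun; exact: continuous_sin. Qed.

Lemma measurable_cos : measurable_fun setT (@cos R : mR -> R).
Proof. by apply: continuous_measurable_fun; exact: continuous_cos. Qed.

Lemma measurable_tan : measurable_fun setT (@tan R : mR -> mR).
Proof.
apply: measurable_funM; first exact: measurable_sin.
apply: (measurableT_comp measurable_invr); exact: measurable_cos.
Qed.

Lemma measurable_invr_sqr (g : mR -> R) : measurable_fun setT g ->
  measurable_fun setT (fun x => (g x ^+ 2)^-1).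
Proof.
by move=> mg; apply: (measurableT_comp measurable_invr); exact: measurable_funX.
Qed.

Let I : set R := `]- (pi / 2), (pi / 2)[.

Let wtan : mR -> R := fun x : R => \1_I x * (cos x ^+ 2)^-1.

Let cosI x : I x -> 0 < cos x.
Proof. by rewrite /I/= in_itv/=; exact: cos_gt0_pihalf. Qed.

(** On an interval the substitution x = tan t is the fundamental theorem of
    calculus, as cos^-2 is the derivative of tan. *)
Lemma integral_tan f : measurable_fun setT f -> (forall x, 0 <= f x)%E ->
  (\int[mu]_x f x =
   \int[mu]_(x in `](- (pi / 2))%R, (pi / 2)%R[) (f (tan x) * ((cos x ^+ 2)^-1)%R%:E))%E.
Proof.
move=> mf f0.
have mw : measurable_fun setT wtan.
  apply: measurable_funM.
    by apply: measurable_indic; exact: measurable_itv.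
  exact: measurable_invr_sqr measurable_cos.
have w0 x : 0 <= wtan x.
  by rewrite mulr_ge0 ?invr_ge0 ?sqr_ge0// indicE.
have wI x : I x -> wtan x = (cos x ^+ 2)^-1.
  by move=> Ix; rewrite /wtan indicE mem_set ?mul1r.
have wN x : ~ I x -> wtan x = 0.
  by move=> Ix; rewrite /wtan indicE memNset ?mul0r.
rewrite [RHS]integral_mkcond (lebesgue_substitution measurable_tan mw w0)//; last first.
  move=> a b ab.
  transitivity (\int[mu]_(x in `]atan a, atan b]) ((cos x ^+ 2)^-1)%R%:E)%E.
    rewrite integral_mkcond [RHS]integral_mkcond; apply: eq_integral => x _.
    rewrite !patchE; have [xI|xI] := pselect (I x); last first.
      rewrite wN// [LHS]if_same memNset//= in_itv/=.
      apply: contra_not xI => /andP[ax xb]; rewrite /I/= in_itv/=.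
      by rewrite (lt_trans (atan_gtNpi2 a))// (le_lt_trans xb (atan_ltpi2 b)).
    rewrite wI//.
    rewrite [X in if X then _ else _](_ : _ = (x \in `]atan a, atan b]%classic))//.
    have cI (y : R) : atan y \in `]- (pi / 2), (pi / 2)[.
      by rewrite in_itv/= atan_gtNpi2 atan_ltpi2.
    have xI' : (x : R) \in `]- (pi / 2), (pi / 2)[ by [].
    have Ha : (a < tan x) = (atan a < x) by rewrite -(ltr_tan (cI a) xI') atanK.
    have Hb : (tan x <= b) = (x <= atan b).
      by rewrite !leNgt -(ltr_tan (cI b) xI') atanK.
    by apply/idP/idP; rewrite !inE/= !in_itv/= Ha Hb.
  have IA x : x \in `[atan a, atan b] -> 0 < cos x.
    rewrite in_itv/= => /andP[ax xb]; apply: cosI; rewrite /I/= in_itv/=.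
    by rewrite (lt_le_trans (atan_gtNpi2 a) ax) (le_lt_trans xb (atan_ltpi2 b)).
  have Lab : atan a < atan b by exact: lt_atan.
  rewrite integral_itv_obnd_cbnd; last first.
    apply/measurable_EFinP/measurable_funTS.
    exact: measurable_invr_sqr measurable_cos.
  rewrite (continuous_FTC2 (F := tan))//; first by rewrite !atanK EFinB.
  - apply: continuous_in_subspaceT => x; rewrite inE/= => /IA cx.
    apply: (@continuousV _ _ (fun x => cos x ^+ 2)); first by rewrite sqrf_eq0 gt_eqF.
    apply: (@continuous_comp _ _ _ cos (fun x => x ^+ 2)).
      exact: continuous_cos.
    exact: exprn_continuous.
  - split.
    + move=> x /subset_itv_oo_cc/IA cx.
      by apply: derivable_tan; rewrite gt_eqF.
    + apply: cvg_at_right_filter; apply: continuous_tan.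
      by rewrite gt_eqF// IA// in_itv/= lexx ltW.
    + apply: cvg_at_left_filter; apply: continuous_tan.
      by rewrite gt_eqF// IA// in_itv/= lexx ltW.
  - move=> x /subset_itv_oo_cc/IA cx; rewrite derive1E.
    by rewrite (@derive_val _ _ _ _ _ _ _ (is_derive_tan _))// gt_eqF.
apply: eq_integral => x _; rewrite patchE; case: ifPn => [/set_mem/wI ->//|].
by rewrite notin_setE => /wN ->; rewrite mule0.
Qed.

(** The cotangent substitution: the previous one precomposed with the reflection
    t |-> pi / 2 - t. *)
Lemma integral_cot f : measurable_fun setT f -> (forall x, 0 <= f x)%E ->
  (\int[mu]_x f x =
   \int[mu]_(x in `]0%R, pi[) (f (cos x / sin x)%R * ((sin x ^+ 2)^-1)%R%:E))%E.
Proof.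
move=> mf f0; rewrite integral_tan// integral_mkcond.
rewrite (@integral_affine (-1) (pi / 2)); last 3 first.
- by rewrite oppr_eq0 oner_neq0.
- apply/(measurable_restrictT _ (measurable_itv _)).
  apply: measurable_funTS; apply: emeasurable_funM.
    exact: measurableT_comp mf measurable_tan.
  apply/measurable_EFinP.
  exact: measurable_invr_sqr measurable_cos.
- move=> x; rewrite patchE; case: ifPn => // _.
  by rewrite mule_ge0// lee_fin invr_ge0 sqr_ge0.
rewrite [RHS]integral_mkcond; apply: eq_integral => x _.
rewrite normrN1 mule1 !patchE.
rewrite [X in if X then _ else _](_ : _ = (x \in `]0%R, pi[%classic)).
  case: ifPn => // _.
  by rewrite mulN1r addrC /tan sinD cosD cosN sinN sin_pihalf cos_pihalf
    !(mul0r, mul1r, mulr0, addr0, add0r, mulrN, opprK, sub0r).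
by apply/idP/idP; rewrite !inE/= !in_itv/= => /andP[h1 h2]; apply/andP; lra.
Qed.

End substitution.

(** * Polar coordinates in a half-plane *)

Section half_plane.
Context {R : realType}.
Local Notation mu := (@lebesgue_measure R).
Local Notation mR := (measurableTypeR R).
Local Open Scope ereal_scope.

Lemma integral_mul_indic d (T : measurableType d) (m : {measure set T -> \bar R})
    (D : set T) (f : T -> \bar R) :
  \int[m]_(x in D) f x = \int[m]_x (f x * (\1_D x)%:E).
Proof. by rewrite integral_mkcond epatch_indic. Qed.

Lemma measurable_indic_comp d1 d2 (T1 : measurableType d1)
    (T2 : measurableType d2) (K : set T2) (g : T1 -> T2) :
  measurable K -> measurable_fun setT g ->
  measurable_fun setT (fun x => \1_K (g x) : R).
Proof.
move=> mK mg; have := @measurable_indic _ T2 R setT _ mK.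
by move=> /measurableT_comp /(_ mg).
Qed.

(** Used to discard finitely many radii or angles. *)
Lemma eq_integral_off_finite (N : set mR) (f g : mR -> \bar R) :
  finite_set N -> measurable_fun setT f -> measurable_fun setT g ->
  (forall x, 0 <= f x) -> (forall x, 0 <= g x) ->
  (forall x, ~ N x -> f x = g x) -> \int[mu]_x f x = \int[mu]_x g x.
Proof.
move=> fN mf mg f0 g0 fg; apply: ge0_ae_eq_integral => //.
exists N; split.
- exact: countable_measurable (finite_set_countable fN).
- exact: countable_lebesgue_measure0 (finite_set_countable fN).
- by move=> x /= H; apply: contrapT => Nx; apply: H => _; exact: fg.
Qed.

Definition pos_ind (s : mR) : R := \1_(`]0%R, +oo[ : set mR) s.

Lemma pos_indE (s : R) : pos_ind s = ((0 < s)%R : nat)%:R.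
Proof. by rewrite /pos_ind indicE mem_setE in_itv/= andbT. Qed.

Lemma measurable_pos_ind : measurable_fun setT pos_ind.
Proof. by apply: measurable_indic; exact: measurable_itv. Qed.

Lemma pos_ind_ge0 s : (0 <= pos_ind s)%R.
Proof. by rewrite pos_indE. Qed.

(** Integrating first along horizontal lines, x = s cot t turns the line at
    height s into an arc of angles; then s = r sin t turns each ray into the
    radial half-line. *)
Lemma integral_half_plane (J : set mR) (h : mR * mR -> \bar R) :
  measurable J -> `]0%R, pi[ `<=` J -> J `<=` `[0%R, pi] ->
  measurable_fun setT h -> (forall p, 0 <= h p) ->
  \int[mu]_x \int[mu]_s (h (x, s) * (pos_ind s)%:E) =
  \int[mu]_t \int[mu]_r
    (h (r * cos t, r * sin t)%R * (\1_J t * (pos_ind r * r))%R%:E).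
Proof.
move=> mJ J1 J2 mh h0.
have mfst : measurable_fun setT (fst : mR * mR -> mR) by exact: measurable_fst.
have msnd : measurable_fun setT (snd : mR * mR -> mR) by exact: measurable_snd.
pose I : set mR := `]0%R, pi[%classic.
have mI : measurable I by exact: measurable_itv.
have mpolar : measurable_fun setT (fun p : mR * mR =>
    ((p.2 : R) * cos p.1, (p.2 : R) * sin p.1)%R : mR * mR).
  apply/measurable_fun_pairP; split; apply: measurable_funM => //.
    exact: (measurableT_comp measurable_cos mfst).
  exact: (measurableT_comp measurable_sin mfst).
have mhJ (K : set mR) : measurable K -> measurable_fun setT (fun p : mR * mR =>
    h ((p.2 : R) * cos p.1, (p.2 : R) * sin p.1)%R *
    (\1_K p.1 * (pos_ind p.2 * (p.2 : R)))%R%:E).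
  move=> mK; apply: emeasurable_funM; first exact: (measurableT_comp mh mpolar).
  apply/measurable_EFinP; apply: measurable_funM.
    exact: measurable_indic_comp.
  apply: measurable_funM => //.
  exact: (measurableT_comp measurable_pos_ind msnd).
have hJ0 (K : set mR) (p : mR * mR) :
    0 <= h ((p.2 : R) * cos p.1, (p.2 : R) * sin p.1)%R *
    (\1_K p.1 * (pos_ind p.2 * (p.2 : R)))%R%:E.
  rewrite mule_ge0// lee_fin mulr_ge0//.
  by rewrite pos_indE; case: ltP => r0; rewrite ?mul0r// mul1r ltW.
(* the endpoints of the angular interval are negligible *)
transitivity (\int[mu]_t \int[mu]_r
    (h ((r : R) * cos t, (r : R) * sin t)%R *
     (\1_I t * (pos_ind r * (r : R)))%R%:E)); last first.
  apply: (@eq_integral_off_finite [set 0%R; pi]).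
  - by rewrite finite_setU; split; exact: finite_set1.
  - exact: (measurable_fun_fubini_tonelli_F (m2 := mu) _ (mhJ _ mI) (hJ0 I)).
  - exact: (measurable_fun_fubini_tonelli_F (m2 := mu) _ (mhJ _ mJ) (hJ0 J)).
  - by move=> t; apply: integral_ge0 => r _; exact: (hJ0 _ (t, r)).
  - by move=> t; apply: integral_ge0 => r _; exact: (hJ0 _ (t, r)).
  move=> t Nt; apply: eq_integral => r _; congr (_ * (_ * _)%:E).
  rewrite !indicE; congr (_ %:R); congr nat_of_bool; apply/idP/idP => /set_mem tI.
    by apply/mem_set/J1.
  apply/mem_set; have /= := J2 _ tI; rewrite /I/= !in_itv/= => /andP[t0 tpi].
  rewrite !lt_neqAle t0 tpi !andbT; apply/andP; split; apply/eqP => tE; apply: Nt.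
    by left.
  by right.
have mh1 : measurable_fun setT (fun p : mR * mR => h p * (pos_ind p.2)%:E).
  apply: emeasurable_funM => //; apply/measurable_EFinP.
  exact: (measurableT_comp measurable_pos_ind msnd).
have h10 p : 0 <= h p * (pos_ind p.2)%:E.
  by rewrite mule_ge0// lee_fin pos_ind_ge0.
rewrite (fubini_tonelli (m1 := mu) (m2 := mu) _ mh1 h10).
pose k (s t : mR) := h ((s : R) * (cos t / sin t), s)%R *
  (pos_ind s * (s : R) * (\1_I t * (sin t ^+ 2)^-1))%R%:E.
have mcot : measurable_fun setT (fun t : mR => (cos t / sin t)%R : mR).
  apply: measurable_funM; first exact: measurable_cos.
  exact: (measurableT_comp measurable_invr measurable_sin).
have mwI : measurable_fun setT (fun t : mR => (\1_I t * (sin t ^+ 2)^-1)%R).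
  apply: measurable_funM; first exact: measurable_indic.
  exact: measurable_invr_sqr measurable_sin.
have mk : measurable_fun setT (fun p : mR * mR => k p.1 p.2).
  apply: emeasurable_funM.
    apply: (measurableT_comp mh); apply/measurable_fun_pairP; split => //=.
    apply: measurable_funM => //.
    exact: (measurableT_comp mcot msnd).
  apply/measurable_EFinP; apply: measurable_funM.
    apply: measurable_funM => //.
    exact: (measurableT_comp measurable_pos_ind mfst).
  exact: (measurableT_comp mwI msnd).
have k0 p : 0 <= k p.1 p.2.
  rewrite mule_ge0// lee_fin mulr_ge0//.
    by rewrite pos_indE; case: ltP => r0; rewrite ?mul0r// mul1r ltW.
  by rewrite mulr_ge0// invr_ge0 sqr_ge0.
transitivity (\int[mu]_s \int[mu]_t k s t).
  apply: eq_integral => s _.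
  have [s0|s0] := ltP 0%R (s : R); last first.
    rewrite !integral0_eq// => t _.
      by rewrite /k pos_indE ltNge s0/= !mul0r mule0.
    by rewrite pos_indE ltNge s0/= mule0.
  have mhs : measurable_fun setT (fun x : mR => h (x, s)).
    by apply: (measurableT_comp mh); exact: pair2_measurable.
  rewrite /k !pos_indE s0/=; under eq_integral do rewrite mule1.
  rewrite (@integral_affine _ (s : R) 0%R)//; last by rewrite gt_eqF.
  under eq_integral do rewrite addr0 gtr0_norm//.
  rewrite (@integral_cot _ (fun x : mR => h ((s : R) * (x : R), s)%R * (s : R)%:E)); last 2 first.
  - apply: emeasurable_funM => //.
    by apply: (measurableT_comp mhs); exact: measurable_funM.
  - by move=> x; rewrite mule_ge0// lee_fin ltW.
  rewrite integral_mul_indic; apply: eq_integral => t _.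
  by rewrite -!muleA -!EFinM mul1r [(\1_ _ _ * _)%R]mulrC.
rewrite (fubini_tonelli (m1 := mu) (m2 := mu) _ mk k0).
apply: eq_integral => t _.
have mkt : measurable_fun setT (fun s : mR => k s t).
  have mt : measurable_fun setT (fun s : mR => (s, t)) by exact: pair2_measurable.
  by have := measurableT_comp mk mt.
have [/set_mem/= tI|tI] := boolP (t \in I); last first.
  by rewrite !integral0_eq// => r _; rewrite /k indicE (negbTE tI) ?(mul0r, mulr0) mule0.
have st : (0 < sin t)%R by apply: sin_gt0_pi; move: tI; rewrite /I/= in_itv.
rewrite (@integral_affine _ (sin t) 0%R)//; last first.
- by move=> s; exact: (k0 (s, t)).
- by rewrite gt_eqF.
apply: eq_integral => r _; rewrite addr0 /k -muleA -EFinM gtr0_norm//.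
rewrite indicE mem_set//= !mul1r.
have -> : (sin t * r * (cos t / sin t) = r * cos t)%R.
  by field; rewrite gt_eqF.
rewrite [(sin t * r)%R]mulrC; congr (_ * _%:E).
rewrite !pos_indE pmulr_lgt0//.
by field; rewrite gt_eqF.
Qed.

End half_plane.

(** * Polar coordinates in Euclidean space *)

Section polar_coordinates.
Context {R : realType}.
Local Notation mu := (@lebesgue_measure R).
Local Notation mR := (measurableTypeR R).
Local Notation E n := (euclidean R n).

(** The coordinates of a polar point after the first one form the polar point of
    radius r sin t in one dimension less; with the next recursions for the
    volume element this is what the inductions on the dimension use. *)
Lemma polar_point_cons n (r t : mR) (a : E n) :
  @polar_point R n.+2 r (tuple_cons (t, a)) =
  tuple_cons ((r * cos t)%R : mR, @polar_point R n.+1 (r * sin t) a).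
Proof.
apply: eq_from_tnth => i; rewrite tnth_mktuple.
case: (unliftP ord0 i) => [j|] ->; last first.
  by rewrite big_ord0 mulr1.
rewrite tnthS tnth_mktuple lift0 big_ord_recl /= mulrA.
by congr (_ * _ * _).
Qed.

Lemma polar_point1 (r : mR) (a : E 0) :
  @polar_point R 1 r a = tuple_cons (r, [tuple] : E 0).
Proof.
apply: eq_from_tnth => i; rewrite tnth_mktuple (ord1 i) big_ord0.
by rewrite !mulr1.
Qed.

Lemma Delta_cons n (t : mR) (a : E n) :
  @Delta R n.+2 (tuple_cons (t, a)) = sin t ^+ n * @Delta R n.+1 a.
Proof.
rewrite /Delta; case: n a => [|n] a; first by rewrite !big_ord0 mulr1.
by rewrite big_ord_recl /= !subSS !subn0.
Qed.

Lemma measurable_nth n (i : nat) : measurable_fun setT (fun a : E n => a`_i : mR).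
Proof.
have [ilt|ige] := ltnP i n.
  rewrite (_ : (fun a : E n => _) = (fun a : E n => tnth a (Ordinal ilt))).
    exact: measurable_tnth.
  by apply/funext => a; rewrite (tnth_nth 0).
rewrite (_ : (fun a : E n => _) = cst (0 : mR)); first exact: measurable_cst.
by apply/funext => a; rewrite nth_default// size_tuple.
Qed.

Lemma measurable_Delta n : measurable_fun setT (@Delta R n.+1 : E n -> R).
Proof.
apply: measurable_prod => i _; apply: measurable_funX.
exact: measurableT_comp measurable_sin (measurable_nth _).
Qed.

Lemma measurable_polar_point d (T : measurableType d) n (r : T -> mR)
    (a : T -> E n) : measurable_fun setT r -> measurable_fun setT a ->
  measurable_fun setT (fun x => @polar_point R n.+1 (r x) (a x)).
Proof.
move=> mr ma; apply/measurable_fun_tnthP => i.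
have mai (j : nat) : measurable_fun setT (fun x => (a x)`_j : mR).
  exact: measurableT_comp (measurable_nth j) ma.
rewrite (_ : _ \o _ = fun x => (r x : R) * (\prod_(j < i) sin ((a x)`_j : R)) *
     (if (i < n)%N then cos ((a x)`_i : R) else 1)); last first.
  by apply/funext => x; rewrite /= tnth_mktuple.
apply: measurable_funM; first apply: measurable_funM => //.
  apply: measurable_prod => j _.
  exact: measurableT_comp measurable_sin (mai j).
case: (i < n)%N; last exact: measurable_cst.
exact: measurableT_comp measurable_cos (mai i).
Qed.

Lemma measurable_angle_domain n : measurable (@angle_domain R n.+1 : set (E n)).
Proof.
rewrite (_ : @angle_domain R n.+1 = \bigcap_(j in [set: 'I_n])
   ((@tnth n mR)^~ j @^-1` (if (j < n.-1)%N then `[0, pi]%classic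
                            else `[0, 2 * pi[%classic))); last first.
  apply/seteqP; split => a.
    by move=> Ha j _ /=; have := Ha j; case: ifP => _ /=; rewrite in_itv.
  by move=> Ha j; have := Ha j I => /=; case: ifP => _ /=; rewrite in_itv.
apply: fin_bigcap_measurable => [|j _]; first exact: finite_finset.
rewrite -[X in measurable X]setTI; apply: measurable_tnth => //.
by case: ifP => _; exact: measurable_itv.
Qed.

Lemma angle_domain_cons n (t : mR) (a : E n.+1) :
  @angle_domain R n.+3 (tuple_cons (t, a)) <->
  (`[0, pi]%classic (t : R) /\ @angle_domain R n.+2 a).
Proof.
split=> [H|[Ht Ha] j].
  split; first by have := H ord0 => /=; rewrite in_itv.
  by move=> j; have := H (lift ord0 j); rewrite tnthS lift0.
case: (unliftP ord0 j) => [i|] ->; first by rewrite tnthS lift0; exact: (Ha i).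
by move: Ht; rewrite /= in_itv.
Qed.

Lemma angle_domain1 (t : mR) (a : E 0) :
  @angle_domain R 2 (tuple_cons (t, a)) <-> `[0, 2 * pi[%classic (t : R).
Proof.
split=> [H|]; first by have := H ord0 => /=; rewrite in_itv.
by rewrite /= in_itv/= => Ht j; rewrite (ord1 j).
Qed.

(** The angular factor of the polar volume element, extended by zero outside
    the angular domain so that integrals can range over whole spaces. *)
Definition angle_weight n (a : E n) : R :=
  \1_(@angle_domain R n.+1 : set (E n)) a * @Delta R n.+1 a.

Lemma angle_weight_cons n (t : mR) (a : E n.+1) :
  angle_weight (tuple_cons (t, a)) =
  \1_(`[0, pi]%classic : set mR) t * sin t ^+ n.+1 * angle_weight a.
Proof.
rewrite /angle_weight Delta_cons !indicE.
rewrite (_ : (_ \in @angle_domain R n.+3) =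
    (t \in (`[0, pi]%classic : set mR)) && (a \in @angle_domain R n.+2)).
  by rewrite -mulnb natrM; ring.
apply/idP/andP => [/set_mem/angle_domain_cons[? ?]|[/set_mem ? /set_mem ?]].
  by split; apply/mem_set.
exact/mem_set/angle_domain_cons.
Qed.

Lemma angle_weight1 (t : mR) (a : E 0) :
  angle_weight (tuple_cons (t, a)) = \1_(`[0, 2 * pi[%classic : set mR) t.
Proof.
rewrite /angle_weight /Delta big_ord0 mulr1 !indicE; congr (_ %:R).
by congr nat_of_bool; apply/idP/idP => /set_mem/angle_domain1 H; apply/mem_set.
Qed.

Lemma angle_weight_ge0 n (a : E n.+1) : 0 <= angle_weight a.
Proof.
elim: n a => [|n IH] a.
  by rewrite -(tuple_unconsK a); case: (tuple_uncons a) => t b;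
    rewrite angle_weight1.
rewrite -(tuple_unconsK a); case: (tuple_uncons a) => t b.
rewrite angle_weight_cons; apply: mulr_ge0; last exact: IH.
rewrite indicE; have [/set_mem/=|] := boolP (_ \in _); last by rewrite mul0r.
by rewrite in_itv/= => /sin_ge0_pi s0; rewrite mul1r exprn_ge0.
Qed.

Lemma measurable_angle_weight n : measurable_fun setT (@angle_weight n).
Proof.
apply: measurable_funM; last exact: measurable_Delta.
by apply: measurable_indic; exact: measurable_angle_domain.
Qed.

Lemma integral_lebesgue1 (f : E 1 -> \bar R) :
  measurable_fun setT f -> (forall x, (0 <= f x)%E) ->
  (\int[lebesgue 1]_y f y = \int[mu]_t f (tuple_cons (t, [tuple] : E 0)))%E.
Proof.
move=> mf f0; rewrite [LHS](integral_cons mu (tuple_measure mu 0) mf f0).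
apply: eq_integral => t _; rewrite /= integral_dirac//.
  by rewrite diracT mul1e.
have mc := @measurable_tuple_cons _ mR 0.
have mt : measurable_fun setT (fun s : E 0 => (t, s)) by exact: pair1_measurable.
exact: measurableT_comp mf (measurableT_comp mc mt).
Qed.

End polar_coordinates.

Section polar_formula.
Context {R : realType}.
Local Notation mu := (@lebesgue_measure R).
Local Notation mR := (measurableTypeR R).
Local Notation E n := (euclidean R n).
Local Open Scope ereal_scope.

(** The weight vanishes outside the polar domain, so that the iterated integrals
    range over whole spaces and can be exchanged without further care. *)
Definition polar_integrand n (f : E n.+2 -> \bar R) (a : E n.+1) (r : mR) :=
  f (@polar_point R n.+2 r a) *
  (angle_weight a * (pos_ind r * r ^+ n.+1))%R%:E.

Lemma measurable_polar_integrand n (f : E n.+2 -> \bar R) :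
  measurable_fun setT f ->
  measurable_fun setT (fun p : E n.+1 * mR => polar_integrand f p.1 p.2).
Proof.
move=> mf; have mfst : measurable_fun setT (fst : E n.+1 * mR -> E n.+1) by [].
have msnd : measurable_fun setT (snd : E n.+1 * mR -> mR) by [].
apply: emeasurable_funM.
  exact: (measurableT_comp mf (measurable_polar_point msnd mfst)).
apply/measurable_EFinP/measurable_funM.
  exact: measurableT_comp (@measurable_angle_weight R _) mfst.
apply: measurable_funM; first exact: measurableT_comp measurable_pos_ind msnd.
exact: measurable_funX.
Qed.

Lemma polar_integrand_ge0 n (f : E n.+2 -> \bar R) a r :
  (forall y, 0 <= f y) -> 0 <= polar_integrand f a r.
Proof.
move=> f0; rewrite mule_ge0// lee_fin mulr_ge0 ?angle_weight_ge0//.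
by rewrite pos_indE; case: ltP => r0; rewrite ?mul0r// mul1r exprn_ge0// ltW.
Qed.

Lemma measurable_angular_integral n (f : E n.+2 -> \bar R) :
  measurable_fun setT f -> (forall y, 0 <= f y) ->
  measurable_fun setT (fun a : E n.+1 => \int[mu]_r polar_integrand f a r).
Proof.
move=> mf f0.
exact: (measurable_fun_fubini_tonelli_F (m2 := mu) _
  (measurable_polar_integrand mf) (fun p => polar_integrand_ge0 p.1 p.2 f0)).
Qed.

Lemma angular_integral_ge0 n (f : E n.+2 -> \bar R) a :
  (forall y, 0 <= f y) -> 0 <= \int[mu]_r polar_integrand f a r.
Proof. by move=> f0; apply: integral_ge0 => r _; exact: polar_integrand_ge0. Qed.

(** The plane is the upper half-plane and its reflection; the reflected half
    receives the angles between pi and 2 pi. *)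
Lemma integral_polar_plane (f : E 2 -> \bar R) :
  measurable_fun setT f -> (forall y, 0 <= f y) ->
  \int[lebesgue 2]_y f y =
  \int[lebesgue 1]_a \int[mu]_r polar_integrand f a r.
Proof.
move=> mf f0; pose g (p : mR * mR) := f (tuple_cons (p.1, tuple_cons (p.2, [tuple] : E 0))).
have mg : measurable_fun setT g.
  apply: (measurableT_comp mf); apply: (measurableT_comp (@measurable_tuple_cons _ _ _)).
  apply: measurable_fun_pair => //.
  apply: (measurableT_comp (@measurable_tuple_cons _ _ _)).
  by apply: measurable_fun_pair.
have g0 p : 0 <= g p by exact: f0.
have mgN : measurable_fun setT (fun p : mR * mR => g (p.1, (- (p.2 : R))%R : mR)).
  apply: (measurableT_comp mg); apply: measurable_fun_pair => //.
  by apply: (measurableT_comp (f := -%R : mR -> mR)) => //; exact: oppr_measurable.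
have mpos : measurable_fun setT (fun p : mR * mR => (pos_ind p.2)%:E).
  by apply/measurable_EFinP; apply: (measurableT_comp measurable_pos_ind).
pose gp (p : mR * mR) := g p * (pos_ind p.2)%:E.
pose gm (p : mR * mR) := g (p.1, (- (p.2 : R))%R : mR) * (pos_ind p.2)%:E.
have mgp : measurable_fun setT gp by exact: emeasurable_funM.
have mgm : measurable_fun setT gm by exact: emeasurable_funM.
have gp0 p : 0 <= gp p by rewrite mule_ge0// lee_fin pos_ind_ge0.
have gm0 p : 0 <= gm p by rewrite mule_ge0// lee_fin pos_ind_ge0.
transitivity (\int[mu]_x (\int[mu]_t gp (x, t) + \int[mu]_t gm (x, t))).
  rewrite [LHS](integral_cons mu (tuple_measure mu 1) mf f0).
  apply: eq_integral => x _.
  have mx : measurable_fun setT (fun t : mR => (x, t)) by exact: pair1_measurable.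
  rewrite [LHS](integral_lebesgue1 (f := fun s : E 1 => f (tuple_cons (x, s))))//; last first.
    apply: (measurableT_comp mf); apply: (measurableT_comp (@measurable_tuple_cons _ _ _)).
    exact: pair1_measurable.
  have mgx : measurable_fun setT (fun t : mR => g (x, t)).
    exact: (measurableT_comp mg mx).
  have mgpx : measurable_fun setT (fun t : mR => gp (x, t)).
    exact: (measurableT_comp mgp mx).
  have mgmx : measurable_fun setT (fun t : mR => g (x, t) * (pos_ind (- (t : R))%R)%:E).
    apply: emeasurable_funM => //; apply/measurable_EFinP.
    apply: (measurableT_comp measurable_pos_ind); exact: oppr_measurable.
  rewrite -[LHS]/(\int[mu]_t g (x, t)).
  transitivity (\int[mu]_t (gp (x, t) + g (x, t) * (pos_ind (- (t : R))%R)%:E)).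
    apply: (@eq_integral_off_finite R [set 0%R]) => //.
    - exact: emeasurable_funD.
    - by move=> t; rewrite adde_ge0// mule_ge0// lee_fin pos_ind_ge0.
    - move=> t /= t0; rewrite /gp !pos_indE/= oppr_gt0.
      case: (ltgtP 0%R (t : R)) => [_|_|/esym/t0//] /=.
        by rewrite mule1 mule0 adde0.
      by rewrite mule1 mule0 add0e.
  rewrite ge0_integralD//; last first.
    by move=> t _; rewrite mule_ge0// lee_fin pos_ind_ge0.
  congr (_ + _); rewrite (@integral_affine R (-1) 0%R)//; last exact: (measurableT_comp mgm mx).
  by apply: eq_integral => t _; rewrite normrN1 mule1 mulN1r addr0 /gm/= opprK.
rewrite ge0_integralD//; last 4 first.
- by move=> x _; apply: integral_ge0 => t _; exact: gp0.
- exact: (measurable_fun_fubini_tonelli_F (m2 := mu) _ mgp gp0).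
- by move=> x _; apply: integral_ge0 => t _; exact: gm0.
- exact: (measurable_fun_fubini_tonelli_F (m2 := mu) _ mgm gm0).
have pi0 := pi_gt0 R.
rewrite (integral_half_plane (J := `[0%R, pi[%classic) _ _ _ mg)//; last 2 first.
- by apply: subset_itvr; rewrite bnd_simp.
- by apply: subset_itvl; rewrite bnd_simp.
rewrite (integral_half_plane (J := `]0%R, pi]%classic)
  (h := fun p : mR * mR => g (p.1, (- (p.2 : R))%R : mR)))//; last 2 first.
- by apply: subset_itvl; rewrite bnd_simp.
- by apply: subset_itvr; rewrite bnd_simp.
pose F (K : set mR) (t : mR) := \int[mu]_r
  (g (r * cos t, r * sin t)%R * (\1_K t * (pos_ind r * r))%R%:E).
have wpos (K : set mR) (t r : mR) : (0 <= \1_K t * (pos_ind r * r))%R.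
  rewrite mulr_ge0//.
  by rewrite pos_indE; case: ltP => r0; rewrite ?mul0r// mul1r ltW.
have F0 K t : 0 <= F K t.
  by apply: integral_ge0 => r _; rewrite mule_ge0// lee_fin wpos.
have mF K : measurable K -> measurable_fun setT (F K).
  move=> mK; apply: (measurable_fun_fubini_tonelli_F (m2 := mu)
    (fun p : mR * mR => g ((p.2 : R) * cos p.1, (p.2 : R) * sin p.1)%R *
      (\1_K p.1 * (pos_ind p.2 * (p.2 : R)))%R%:E)); last first.
    by move=> p; rewrite mule_ge0// lee_fin wpos.
  have mfst : measurable_fun setT (fst : mR * mR -> mR) by [].
  have msnd : measurable_fun setT (snd : mR * mR -> mR) by [].
  apply: emeasurable_funM.
    apply: (measurableT_comp mg); apply: measurable_fun_pair.
      by apply: measurable_funM => //; exact: (measurableT_comp measurable_cos mfst).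
    by apply: measurable_funM => //; exact: (measurableT_comp measurable_sin mfst).
  apply/measurable_EFinP; apply: measurable_funM; first exact: measurable_indic_comp.
  by apply: measurable_funM => //; exact: (measurableT_comp measurable_pos_ind msnd).
have mFt (K : set mR) (t : mR) : measurable K -> measurable_fun setT (fun r : mR =>
    g (r * cos t, r * sin t)%R * (\1_K t * (pos_ind r * r))%R%:E).
  move=> mK; apply: emeasurable_funM.
    by apply: (measurableT_comp mg); apply: measurable_fun_pair;
      exact: measurable_funM.
  apply/measurable_EFinP; apply: measurable_funM => //.
  by apply: measurable_funM => //; exact: measurable_pos_ind.
transitivity (\int[mu]_t F `[0%R, pi[%classic t + \int[mu]_t F `[pi, (2 * pi)%R[%classic t).
  congr (_ + _).
  rewrite [RHS](@integral_affine R (-1) (2 * pi)%R)//; last first.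
    by apply: mF; exact: measurable_itv.
  apply: eq_integral => t _; rewrite normrN1 mule1; apply: eq_integral => r _ /=.
  rewrite mulN1r mulr_natl cosD2pi cosN sinD2pi sinN mulrN.
  congr (_ * (_ * _)%:E); rewrite !indicE; congr (nat_of_bool _)%:R.
  by apply/idP/idP; rewrite !inE/= !in_itv/= => /andP[h1 h2]; apply/andP; lra.
rewrite -ge0_integralD//; last 2 first.
- by apply: mF; exact: measurable_itv.
- by apply: mF; exact: measurable_itv.
rewrite [RHS]integral_lebesgue1; last 2 first.
- exact: measurable_angular_integral.
- by move=> a; exact: angular_integral_ge0.
apply: eq_integral => t _; rewrite -ge0_integralD//; last 4 first.
- by move=> r _; rewrite mule_ge0// lee_fin wpos.
- by apply: mFt; exact: measurable_itv.
- by move=> r _; rewrite mule_ge0// lee_fin wpos.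
- by apply: mFt; exact: measurable_itv.
apply: eq_integral => r _.
rewrite -ge0_muleDr ?lee_fin ?wpos// /polar_integrand polar_point_cons.
rewrite polar_point1 angle_weight1 -EFinD -mulrDl; congr (_ * (_ * _)%:E).
rewrite !indicE -natrD; congr (_ %:R).
rewrite !mem_setE !in_itv/=.
case: (leP 0%R t) => /= t0; last by rewrite leNgt (lt_trans t0).
by have [tp|tp] := ltP t pi => //=; rewrite (lt_le_trans tp)//; lra.
Qed.

End polar_formula.

Section polar_induction.
Context {R : realType}.
Local Notation mu := (@lebesgue_measure R).
Local Notation mR := (measurableTypeR R).
Local Notation E n := (euclidean R n).
Local Open Scope ereal_scope.

(** Integration in polar coordinates, by induction on the dimension: write
    y = (y_1, y'), use the formula in the hyperplane for y', and turn the pair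
    formed by y_1 and the radius of y' into a radius and one more angle. *)
Lemma integral_polar n (f : E n.+2 -> \bar R) :
  measurable_fun setT f -> (forall y, 0 <= f y) ->
  \int[lebesgue n.+2]_y f y =
  \int[lebesgue n.+1]_a \int[mu]_r polar_integrand f a r.
Proof.
elim: n f => [|n IH] f mf f0; first exact: integral_polar_plane.
have mfst d1 d2 (T1 : measurableType d1) (T2 : measurableType d2) :
  measurable_fun setT (fst : T1 * T2 -> T1) by [].
have msnd d1 d2 (T1 : measurableType d1) (T2 : measurableType d2) :
  measurable_fun setT (snd : T1 * T2 -> T2) by [].
rewrite [LHS](integral_cons mu (tuple_measure mu n.+2) mf f0).
pose g (x : mR) (y : E n.+2) := f (tuple_cons (x, y)).
have mgg : measurable_fun setT (fun p : mR * E n.+2 => g p.1 p.2).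
  apply: (measurableT_comp mf); apply: (measurableT_comp (@measurable_tuple_cons _ _ _)).
  exact: measurable_fun_pair.
have mg x : measurable_fun setT (g x).
  have mx : measurable_fun setT (fun y : E n.+2 => (x, y)) by exact: pair1_measurable.
  exact: measurableT_comp mgg mx.
have w0 (a : E n.+1) (s : mR) : (0 <= angle_weight a * (pos_ind s * s ^+ n.+1))%R.
  rewrite mulr_ge0 ?angle_weight_ge0//.
  by rewrite pos_indE; case: ltP => r0; rewrite ?mul0r// mul1r exprn_ge0// ltW.
have mG : measurable_fun setT (fun q : (mR * E n.+1) * mR =>
    polar_integrand (g q.1.1) q.1.2 q.2).
  have m1 : measurable_fun setT (fun q : (mR * E n.+1) * mR => q.1.1).
    exact: (measurableT_comp (mfst _ _ _ _) (mfst _ _ _ _)).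
  have m2 : measurable_fun setT (fun q : (mR * E n.+1) * mR => q.1.2).
    exact: (measurableT_comp (msnd _ _ _ _) (mfst _ _ _ _)).
  have m3 : measurable_fun setT (fun q : (mR * E n.+1) * mR => q.2).
    exact: (msnd _ _ _ _).
  apply: emeasurable_funM.
    have mp := measurable_polar_point m3 m2.
    exact: (measurableT_comp mgg (measurable_fun_pair m1 mp)).
  apply/measurable_EFinP/measurable_funM.
    exact: measurableT_comp (@measurable_angle_weight R _) m2.
  apply: measurable_funM; first exact: measurableT_comp measurable_pos_ind m3.
  exact: measurable_funX.
have G0 q : 0 <= polar_integrand (g q.1.1) q.1.2 q.2.
  by apply: polar_integrand_ge0 => y; exact: f0.
have mFG := measurable_fun_fubini_tonelli_F (m2 := mu) _ mG G0.
transitivity (\int[mu]_x \int[lebesgue n.+1]_a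
    \int[mu]_r polar_integrand (g x) a r).
  by apply: eq_integral => x _; rewrite -IH// => y; exact: f0.
rewrite (fubini_tonelli (m1 := mu) (m2 := lebesgue n.+1) _ mFG); last first.
  by move=> p; apply: integral_ge0 => r _; exact: (G0 (p, r)).
rewrite [RHS](integral_cons_swap mu (tuple_measure mu n.+1)
  (f := fun a => \int[mu]_r polar_integrand f a r)); last 2 first.
- exact: measurable_angular_integral.
- by move=> a; exact: angular_integral_ge0.
apply: eq_integral => a _.
pose h (p : mR * mR) := polar_integrand (g p.1) a p.2.
have mh : measurable_fun setT h.
  have m1 : measurable_fun setT (fun p : mR * mR => ((p.1, a), p.2)).
    by apply: measurable_fun_pair => //; apply: measurable_fun_pair.
  exact: measurableT_comp mG m1.
transitivity (\int[mu]_x \int[mu]_s (h (x, s) * (pos_ind s)%:E)).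
  apply: eq_integral => x _; apply: eq_integral => s _.
  rewrite /h /polar_integrand/= -muleA -EFinM -!mulrA; congr (_ * (_ * _)%:E).
  by rewrite pos_indE; case: (0 < s)%R; rewrite ?mul0r// !mul1r mulr1.
rewrite (integral_half_plane (J := `[0%R, pi]%classic) _ _ _ mh)//; last 2 first.
- by apply: subset_itv; rewrite bnd_simp.
- by move=> p; exact: (G0 (p.1, a, p.2)).
apply: eq_integral => t _; apply: eq_integral => r _.
rewrite /h /polar_integrand/= /g polar_point_cons -muleA -EFinM.
congr (_ * _%:E); rewrite angle_weight_cons indicE.
have [/set_mem/=|_] := boolP (_ \in _); last by rewrite !(mul0r, mulr0).
rewrite in_itv/= => /sin_ge0_pi; rewrite le_eqVlt => /predU1P[<-|st].
  by rewrite mulr0 exprS mul0r !(mulr0, mul0r).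
rewrite !pos_indE pmulr_lgt0// exprMn [(r ^+ n.+2)%R]exprS.
have ringE (b : bool) (w u v x : R) :
    (w * (b%:R * (v * u)) * (1 * (b%:R * x)) = 1 * u * w * (b%:R * (x * v)))%R.
  by case: b; rewrite /= ?mulr0n ?mulr1n; ring.
exact: ringE.
Qed.

End polar_induction.

(** * Euclidean geometry and scaling *)

Section euclidean_geometry.
Context {R : realType}.
Local Notation mu := (@lebesgue_measure R).
Local Notation mR := (measurableTypeR R).
Local Notation E n := (euclidean R n).

(** The sum of the squares of B a_i - C b_i, where B and C are the sums of b_i ^ 2
    and a_i b_i, is nonnegative. *)
Lemma cauchy_schwarz (I : finType) (a b : I -> R) :
  (\sum_i a i * b i) ^+ 2 <= (\sum_i a i ^+ 2) * (\sum_i b i ^+ 2).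
Proof.
set A := \sum_i a i ^+ 2; set B := \sum_i b i ^+ 2; set C := \sum_i a i * b i.
have B0 : 0 <= B by apply: sumr_ge0 => i _; exact: sqr_ge0.
have [B0'|Bp] := eqVneq B 0.
  have b0 i : b i = 0.
    apply/eqP; rewrite -sqrf_eq0.
    by move/eqP: B0'; rewrite psumr_eq0 => [/allP/(_ i)|j _]; [apply; rewrite mem_index_enum|exact: sqr_ge0].
  by rewrite B0' mulr0 /C big1 ?expr0n// => i _; rewrite b0 mulr0.
have {}Bp : 0 < B by rewrite lt_def Bp.
have : 0 <= \sum_i (B * a i - C * b i) ^+ 2 by apply: sumr_ge0 => i _; exact: sqr_ge0.
rewrite (_ : \sum_i _ = B * (A * B - C ^+ 2)) ?pmulr_rge0 ?subr_ge0//.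
rewrite (eq_bigr (fun i => B ^+ 2 * (a i ^+ 2) - (2 * B * C) * (a i * b i) + C ^+ 2 * (b i ^+ 2))).
  by rewrite big_split/= sumrB -!mulr_sumr -/A -/B -/C; ring.
by move=> i _; ring.
Qed.

Lemma enormE n (x : E n) : enorm x ^+ 2 = \sum_(i < n) (tnth x i : R) ^+ 2.
Proof. by rewrite sqr_sqrtr// sumr_ge0// => i _; exact: sqr_ge0. Qed.

Lemma enorm_ge0 n (x : E n) : 0 <= enorm x.
Proof. exact: sqrtr_ge0. Qed.

Lemma edist_ge0 n (x y : E n) : 0 <= edist x y.
Proof. exact: sqrtr_ge0. Qed.

Lemma edistE n (x y : E n) :
  edist x y ^+ 2 = \sum_(i < n) ((tnth x i : R) - (tnth y i : R)) ^+ 2.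
Proof. by rewrite sqr_sqrtr// sumr_ge0// => i _; exact: sqr_ge0. Qed.

Lemma edistC n (x y : E n) : edist x y = edist y x.
Proof. by congr Num.sqrt; apply: eq_bigr => i _; rewrite -sqrrN opprB. Qed.

Lemma sqrt_sum_triangle n (a b : 'I_n -> R) :
  Num.sqrt (\sum_i (a i + b i) ^+ 2) <=
  Num.sqrt (\sum_i a i ^+ 2) + Num.sqrt (\sum_i b i ^+ 2).
Proof.
have S0 (c : 'I_n -> R) : 0 <= \sum_i c i ^+ 2.
  by apply: sumr_ge0 => i _; exact: sqr_ge0.
rewrite -(ler_pXn2r (n := 2))// ?nnegrE ?addr_ge0 ?sqrtr_ge0//.
rewrite sqrrD !sqr_sqrtr// -sqrtrM//.
rewrite (eq_bigr (fun i => a i ^+ 2 + (a i * b i) *+ 2 + b i ^+ 2)) => [|i _]; last first.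
  by rewrite sqrrD.
rewrite big_split/= lerD2r big_split/= lerD2l sumrMnl lerMn2r/=.
apply: le_trans (ler_norm _) _; rewrite -sqrtr_sqr; apply: ler_wsqrtr.
exact: cauchy_schwarz.
Qed.

Lemma edist_triangle n (x y z : E n) : edist x z <= edist x y + edist y z.
Proof.
apply: le_trans (sqrt_sum_triangle _ _).
rewrite le_eqVlt; apply/orP; left; apply/eqP; congr Num.sqrt.
by apply: eq_bigr => i _; rewrite addrA subrK.
Qed.

Lemma enorm_triangle n (x y : E n) : enorm x <= edist x y + enorm y.
Proof.
apply: le_trans (sqrt_sum_triangle _ _).
rewrite le_eqVlt; apply/orP; left; apply/eqP; congr Num.sqrt.
by apply: eq_bigr => i _; rewrite subrK.
Qed.

Lemma measurable_edist d (T : measurableType d) n (f g : T -> E n) :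
  measurable_fun setT f -> measurable_fun setT g ->
  measurable_fun setT (fun x => edist (f x) (g x)).
Proof.
move=> mf mg.
have ms : measurable_fun setT (@Num.sqrt R).
  by apply: nondecreasing_measurable => // x y; exact: ler_wsqrtr.
apply: (measurableT_comp ms); apply: measurable_sum => i.
apply: measurable_funX; apply: measurable_funB.
  exact: (measurableT_comp (measurable_tnth (T := mR) i) mf).
exact: (measurableT_comp (measurable_tnth (T := mR) i) mg).
Qed.

Lemma measurable_eball n (r : R) : measurable (@eball R n r).
Proof.
rewrite -[X in measurable X]setTI.
rewrite (_ : eball n r = @enorm R n @^-1` `]-oo, r]%classic).
  by apply: measurable_enorm => //; exact: measurable_itv.
by apply/seteqP; split => x /=; rewrite in_itv.
Qed.

Definition escale n (c : R) (x : E n) : E n := [tuple (c * (tnth x i : R) : mR) | i < n].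

Lemma measurable_escale n c : measurable_fun setT (@escale n c).
Proof.
apply/measurable_fun_tnthP => i.
rewrite (_ : _ \o _ = fun x : E n => c * (tnth x i : R)); last first.
  by apply/funext => x; rewrite /= tnth_mktuple.
by apply: measurable_funM => //; exact: (measurable_tnth (T := mR) i).
Qed.

Lemma enorm_escale n c (x : E n) : 0 <= c -> enorm (escale c x) = c * enorm x.
Proof.
move=> c0; rewrite /enorm (eq_bigr (fun i => c ^+ 2 * (tnth x i : R) ^+ 2)).
  by rewrite -mulr_sumr sqrtrM ?sqr_ge0// sqrtr_sqr ger0_norm.
by move=> i _; rewrite tnth_mktuple exprMn.
Qed.

Lemma escale_cons n c (x : mR) (y : E n) :
  escale c (tuple_cons (x, y)) = tuple_cons (c * (x : R) : mR, escale c y).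
Proof.
apply: eq_from_tnth => i; rewrite tnth_mktuple.
case: (unliftP ord0 i) => [j|] ->; last by [].
by rewrite !tnthS tnth_mktuple.
Qed.

Lemma integral_escale n (c : R) (f : E n -> \bar R) : 0 < c ->
  measurable_fun setT f -> (forall y, (0 <= f y)%E) ->
  (\int[lebesgue n]_y f y = \int[lebesgue n]_y (f (escale c y) * (c ^+ n)%:E))%E.
Proof.
move=> c0; elim: n f => [|n IH] f mf f0.
  apply: eq_integral => y _; rewrite expr0 mule1; congr f.
  by rewrite (tuple0 y) (tuple0 (escale _ _)).
have mfs : measurable_fun setT (fun y => f (escale c y) * (c ^+ n.+1)%:E)%E.
  by apply: emeasurable_funM => //; exact: measurableT_comp mf (measurable_escale _).
have fs0 y : (0 <= f (escale c y) * (c ^+ n.+1)%:E)%E.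
  by rewrite mule_ge0// lee_fin exprn_ge0// ltW.
rewrite [LHS](integral_cons mu (tuple_measure mu n) mf f0).
rewrite [RHS](integral_cons mu (tuple_measure mu n) mfs fs0).
have mfc : measurable_fun setT (fun p : mR * E n => f (tuple_cons p)).
  exact: measurableT_comp mf (@measurable_tuple_cons _ _ _).
have mfx x : measurable_fun setT (fun y : E n => f (tuple_cons (x, y))).
  have mx : measurable_fun setT (fun y : E n => (x, y)) by exact: pair1_measurable.
  exact: measurableT_comp mfc mx.
have mF := measurable_fun_fubini_tonelli_F (m2 := tuple_measure mu n) _ mfc (fun p => f0 _).
rewrite (@integral_affine R c 0 _ _ mF) ?gt_eqF//; last first.
  by move=> x; apply: integral_ge0.
apply: eq_integral => x _; rewrite addr0 /fubini_F.
rewrite [X in (X * _)%E = _](IH (fun s => f (tuple_cons (c * (x : R) : mR, s))))//.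
rewrite gtr0_norm// -ge0_integralZr//; last 3 first.
- apply: emeasurable_funM => //.
  exact: (measurableT_comp (mfx _) (measurable_escale _)).
- by move=> y _; rewrite mule_ge0// lee_fin exprn_ge0// ltW.
- by rewrite lee_fin ltW.
by apply: eq_integral => y _; rewrite escale_cons -muleA -EFinM exprSr.
Qed.

End euclidean_geometry.

(** * The volume of a ball *)

Section ball_volume.
Context {R : realType}.
Local Notation mu := (@lebesgue_measure R).
Local Notation mR := (measurableTypeR R).
Local Notation E n := (euclidean R n).

Lemma integral_expRN_tail (c : R) :
  (\int[mu]_(s in `[c, +oo[) (expR (- s))%:E = (expR (- c))%:E)%E.
Proof.
have cexpN : continuous (fun z : R => expR (- z)).
  move=> z; apply: continuous_comp; last exact: continuous_expR.
  exact: (@continuousN _ R).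
rewrite (@ge0_continuous_FTC2y _ _ (fun x : R => - expR (- x)) _ 0)//.
- by rewrite EFinN oppeK add0e.
- by apply: (@continuous_subspaceT R R); exact: cexpN.
- by rewrite -oppr0; apply: cvgN; exact: cvgr_expR.
- by apply: cvgN; apply/cvg_at_right_filter; exact: cexpN.
- move=> x _; rewrite derive1_comp// derive1N// derive1_id mulN1r.
  rewrite derive1_comp// derive1N// derive1_id derive1E.
  have /funeqP -> := @derive_expR R.
  by rewrite mulrN1 opprK.
Qed.

Lemma integral_indicT d (T : measurableType d) (m : {measure set T -> \bar R})
    (A : set T) : measurable A -> (\int[m]_x (\1_A x)%:E = m A)%E.
Proof. by move=> mA; rewrite integral_indic// setIT. Qed.

Lemma integral_gauss_euclidean n :
  (\int[lebesgue n]_y (expR (- enorm (y : E n) ^+ 2))%:E =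
   (Num.sqrt pi ^+ n : R)%:E)%E.
Proof.
transitivity (\int[lebesgue n]_y (\prod_(i < n) (gauss_fun (tnth y i : R)))%:E)%E.
  apply: eq_integral => y _; rewrite enormE -sumrN expR_sum//.
rewrite [LHS](integral_tuple_prod mu (h := @gauss_fun R : mR -> R))//.
- by rewrite integralT_gauss EFin_expe.
- exact: measurable_gauss_fun.
- by move=> x; exact: gauss_fun_ge0.
Qed.

Lemma mem_eball n (r : R) (y : E n) : (y \in eball n r) = (enorm y <= r).
Proof. by apply/idP/idP; rewrite inE. Qed.

Lemma lebesgue_eball_scale n (r : R) : 0 < r ->
  (lebesgue n (eball n r) = (r ^+ n)%:E * lebesgue n (eball n 1))%E.
Proof.
move=> r0; rewrite -integral_indicT; last exact: measurable_eball.
rewrite (integral_escale r0)//; last first.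
  by apply/measurable_EFinP/measurable_indic; exact: measurable_eball.
rewrite ge0_integralZr//; last 2 first.
- apply/measurable_EFinP; apply: measurable_indic_comp (@measurable_escale _ _ _).
  exact: measurable_eball.
- by rewrite lee_fin exprn_ge0// ltW.
rewrite muleC; congr (_ * _)%E.
rewrite -[RHS]integral_indicT; last exact: measurable_eball.
apply: eq_integral => y _; congr (_%:E); rewrite !indicE; congr (nat_of_bool _)%:R.
by rewrite !mem_eball enorm_escale ?(ltW r0)// ger_pMr.
Qed.

(** The integral of exp(- |y|^2) is a product of one-dimensional Gaussian
    integrals; slicing it into balls gives a Gamma integral times the volume of
    the unit ball. *)
Lemma lebesgue_unit_ball n :
  0 < @kappa R n /\ lebesgue n (eball n 1) = (@kappa R n)%:E.
Proof.
set V := lebesgue n (eball n 1).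
pose G : \bar R := (\int[mu]_(t in `]0%R, +oo[)
  (t `^ (n%:R / 2 + 1 - 1) * expR (- t))%R%:E)%E.
have V0 : (0 <= V)%E by exact: measure_ge0.
have G0 : (0 <= G)%E.
  by apply: integral_ge0 => t _; rewrite lee_fin mulr_ge0 ?powR_ge0 ?expR_ge0.
have mexpN : measurable_fun setT (fun s : mR => expR (- (s : R))).
  by apply: (measurableT_comp (@measurable_expR R)); exact: oppr_measurable.
have GV : (G * V = (Num.sqrt pi ^+ n : R)%:E)%E.
  (* exp(- |y|^2) is the integral of exp(- s) over s >= |y|^2 *)
  pose k (p : E n * mR) : \bar R :=
    (if enorm p.1 ^+ 2 <= (p.2 : R) then expR (- (p.2 : R)) else 0)%R%:E.
  have mk : measurable_fun setT k.
    apply/measurable_EFinP; apply: measurable_fun_ifT => //.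
      apply: measurable_fun_ler => //; apply: measurable_funX.
      exact: (measurableT_comp (@measurable_enorm R n)).
    exact: (measurableT_comp mexpN).
  have k0 p : (0 <= k p)%E by rewrite lee_fin; case: ifP => // _; exact: expR_ge0.
  transitivity (\int[lebesgue n]_y \int[mu]_s k (y, s))%E; last first.
    rewrite -integral_gauss_euclidean; apply: eq_integral => y _.
    rewrite -(integral_expRN_tail (enorm y ^+ 2)) [RHS]integral_mkcond.
    apply: eq_integral => s _; rewrite patchE /k/= mem_setE in_itv/= andbT.
    by case: ifP.
  rewrite (fubini_tonelli (m1 := lebesgue n) (m2 := mu) _ mk k0).
  have mpow : measurable_fun setT (fun t : mR =>
      ((t : R) `^ (n%:R / 2 + 1 - 1) * expR (- (t : R)))%R).
    by apply: measurable_funM => //; exact: measurable_powR.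
  rewrite /G integral_mul_indic -ge0_integralZr//; last 2 first.
  - apply: emeasurable_funM; first exact/measurable_EFinP.
    by apply/measurable_EFinP; exact: measurable_pos_ind.
  - move=> t _; rewrite mule_ge0// lee_fin mulr_ge0 ?powR_ge0 ?expR_ge0//.
  apply: (@eq_integral_off_finite R [set 0%R]) => //.
  - apply: emeasurable_funM => //; apply: emeasurable_funM; first exact/measurable_EFinP.
    by apply/measurable_EFinP; exact: measurable_pos_ind.
  - exact: (measurable_fun_fubini_tonelli_G (m1 := lebesgue n) _ mk k0).
  - move=> t; rewrite mule_ge0// mule_ge0// lee_fin mulr_ge0 ?powR_ge0 ?expR_ge0//.
  - by move=> t; apply: integral_ge0 => y _; exact: k0.
  move=> t /= t0; rewrite -/(pos_ind t) pos_indE.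
  case: (ltgtP 0 (t : R)) => [tp|tn|/esym/t0//] /=; last first.
    rewrite mule0 mul0e integral0_eq// => y _; rewrite /k/= leNgt.
    by rewrite (lt_le_trans tn) ?sqr_ge0.
  rewrite mule1 addrK.
  transitivity ((expR (- (t : R)))%:E * lebesgue n (eball n (Num.sqrt (t : R))))%E.
    rewrite lebesgue_eball_scale ?sqrtr_gt0// muleA -EFinM [(expR _ * _)%R]mulrC.
    congr ((_ * _)%:E * _)%E.
    by rewrite mulrC powRrM powR12_sqrt ?(ltW tp)// powR_mulrn ?sqrtr_ge0.
  rewrite -integral_indicT; last exact: measurable_eball.
  rewrite -ge0_integralZl//; last first.
    by apply/measurable_EFinP/measurable_indic; exact: measurable_eball.
  apply: eq_integral => y _; rewrite -EFinM indicE mem_eball /k/=; congr (_%:E).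
  have -> : (enorm y ^+ 2 <= (t : R)) = (enorm y <= Num.sqrt (t : R)).
    by rewrite -[in LHS](sqr_sqrtr (ltW tp)) ler_pXn2r// nnegrE ?sqrtr_ge0.
  by case: (_ <= _); rewrite ?mulr1 ?mulr0.
have p0 : 0 < Num.sqrt pi ^+ n :> R by rewrite exprn_gt0// sqrtr_gt0 pi_gt0.
have GE : G = (fine G)%:E.
  case: (G) GV G0 => // GV _; move: V0 GV; rewrite le_eqVlt => /predU1P[<-|V0].
    by rewrite mule0 => -[] E0; move: p0; rewrite -E0 ltxx.
  by rewrite gt0_mulye.
have VE : V = (fine V)%:E.
  case: (V) GV V0 => // GV _; move: G0 GV; rewrite le_eqVlt => /predU1P[<-|G0'].
    by rewrite mul0e => -[] E0; move: p0; rewrite -E0 ltxx.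
  by rewrite gt0_muley.
have GVr : fine G * fine V = Num.sqrt pi ^+ n by apply: EFin_inj; rewrite EFinM -GE -VE.
have Gp : 0 < fine G.
  rewrite lt_def fine_ge0// andbT; apply/eqP => G00.
  by move: p0; rewrite -GVr G00 mul0r ltxx.
have -> : @kappa R n = fine V.
  rewrite /kappa /Gamma -/G.
  have -> : pi `^ (n%:R / 2) = Num.sqrt pi ^+ n :> R.
    by rewrite mulrC powRrM powR12_sqrt ?pi_ge0// powR_mulrn// sqrtr_ge0.
  by rewrite -GVr mulrC mulrA -[Rintegral _ _ _]/(fine G) mulVf ?mul1r// gt_eqF.
split=> //; by move: p0; rewrite -GVr pmulr_rgt0.
Qed.

Lemma kappa_gt0 n : 0 < @kappa R n.
Proof. by have [] := lebesgue_unit_ball n. Qed.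

Lemma lebesgue_eball n (r : R) : 0 < r ->
  lebesgue n (eball n r) = (@kappa R n * r ^+ n)%:E.
Proof.
move=> r0; rewrite lebesgue_eball_scale//.
by have [_ ->] := lebesgue_unit_ball n; rewrite -EFinM mulrC.
Qed.

End ball_volume.

(** * Point configurations and Rényi's theorem *)

Section configurations.
Context {R : realType}.
Local Notation mu := (@lebesgue_measure R).
Local Notation mR := (measurableTypeR R).
Local Notation E n := (euclidean R n).

Definition void_event n (A : set (E n)) : set (set (E n)) :=
  [set X | X `&` A = set0].

Definition void_events n : set (set (set (E n))) :=
  [set void_event A | A in measurable].

(** The sigma-algebra is generated by the void events, which form a pi-system. *)
Definition configuration n := g_sigma_algebraType (@void_events n).

Lemma measurable_void_event n (A : set (E n)) : measurable A ->
  measurable (void_event A : set (configuration n)).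
Proof. by move=> mA; apply: sub_sigma_algebra; exists A. Qed.

Lemma void_events_setI_closed n : setI_closed (@void_events n).
Proof.
move=> _ _ [A mA <-] [B mB <-]; exists (A `|` B); first exact: measurableU.
by apply/seteqP; split => X /=; rewrite /void_event/= setIUr setU_eq0.
Qed.

Lemma void_event0 n : @void_event n set0 = setT.
Proof. by apply/seteqP; split => X //= _; rewrite /void_event/= setI0. Qed.

(** Rényi's theorem, as an instance of the uniqueness of measures on a pi-system:
    two void events intersect in the void event of the union of the two sets. *)
Lemma eq_void_probability n (m1 m2 : {measure set (configuration n) -> \bar R}) :
  (m1 setT < +oo)%E ->
  (forall A, measurable A -> m1 (void_event A) = m2 (void_event A)) ->
  forall S, measurable S -> m1 S = m2 S.
Proof.
move=> m1oo m12 S mS.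
apply: (@measure_unique _ R (configuration n) (@void_events n) (fun=> setT)
  erefl (@void_events_setI_closed n) _ _ m1 m2) => //.
- by move=> _; rewrite -(@void_event0 n); exists set0.
- by rewrite bigcup_const//; exists 0%N.
- by move=> _ [A mA <-]; exact: m12.
Qed.

Lemma measurable_to_configuration d (T : measurableType d) n
    (phi : T -> configuration n) :
  (forall A, measurable A -> measurable (phi @^-1` void_event A)) ->
  measurable_fun setT phi.
Proof.
move=> H; apply: (@measurability _ _ T (configuration n) setT phi (@void_events n)) => //.
by move=> _ [_ [A mA <-] <-]; rewrite setTI; exact: H.
Qed.

Definition rat_point n (q : n.-tuple rat) : E n :=
  [tuple (ratr (tnth q i) : mR) | i < n].

Lemma dense_rat_point n (x : E n) (e : R) : 0 < e ->
  exists q, edist x (rat_point q) < e.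
Proof.
move=> e0; pose h := e / n.+1%:R.
have h0 : 0 < h by rewrite divr_gt0.
have /fin_all_exists[q Hq] (i : 'I_n) :
    exists r : rat, (tnth x i : R) - h < ratr r < (tnth x i : R) + h.
  have /rat_in_itvoo[r] : (tnth x i : R) - h < (tnth x i : R) + h by lra.
  by rewrite in_itv; exists r.
exists [tuple q i | i < n].
rewrite -(ltr_pXn2r (n := 2))// ?nnegrE ?edist_ge0 ?(ltW e0)// edistE.
apply: (@le_lt_trans _ _ (\sum_(i < n) h ^+ 2)).
  apply: ler_sum => i _; rewrite !tnth_mktuple -subr_ge0 subr_sqr.
  by have /andP[? ?] := Hq i; rewrite mulr_ge0//; lra.
have -> : \sum_(i < n) h ^+ 2 = e ^+ 2 * (n%:R / n.+1%:R ^+ 2).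
  rewrite sumr_const card_ord /h expr_div_n -[LHS]mulr_natr.
  by rewrite mulrAC mulrA.
rewrite gtr_pMr ?exprn_gt0// ltr_pdivrMr ?exprn_gt0// mul1r.
by rewrite -natrX ltr_nat expnS expn1 mulSn leq_addr.
Qed.

(** The set of pairs (x, y) with |x - y| < |y| is open, hence a countable union
    of rectangles with rational data. *)
Lemma edist_lt_enormP n (x y : E n) : edist x y < enorm y <->
  exists u : n.-tuple rat * rat, edist x (rat_point u.1) < ratr u.2 /\
    edist y (rat_point u.1) + ratr u.2 < enorm y.
Proof.
split=> [xy|[[q r]/= [xq yq]]]; last first.
  apply: le_lt_trans yq; apply: le_trans (edist_triangle _ (rat_point q) _) _.
  by rewrite addrC (edistC _ y) lerD2l ltW.
have /rat_in_itvoo[r] : 0 < (enorm y - edist x y) / 2 by rewrite divr_gt0// subr_gt0.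
rewrite in_itv/= => /andP[r0 rl].
have [q xq] := dense_rat_point x r0.
exists (q, r); split => //=.
have := edist_triangle y x (rat_point q); rewrite (edistC y x).
lra.
Qed.

(** Describes the cell by countably many void events, each paired with a
    condition on y alone. *)
Lemma typical_cellP n (X : set (E n)) y : typical_cell X y <->
  forall u : n.-tuple rat * rat,
    X `&` [set x | edist x (rat_point u.1) < ratr u.2] = set0 \/
    ~ (edist y (rat_point u.1) + ratr u.2 < enorm y).
Proof.
split=> [H u|H x Xx].
  have [yu|?] := pselect (edist y (rat_point u.1) + ratr u.2 < enorm y); last by right.
  left; apply/seteqP; split => // x [Xx /= xu].
  have /edist_lt_enormP : exists u : n.-tuple rat * rat,
    edist x (rat_point u.1) < ratr u.2 /\
    edist y (rat_point u.1) + ratr u.2 < enorm y by exists u.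
  by rewrite ltNge H.
rewrite leNgt; apply/negP => /edist_lt_enormP[u [xu yu]].
by have [X0|//] := H u; have : set0 x by rewrite -X0.
Qed.

Definition cell_graph n : set (configuration n * E n) :=
  [set p | typical_cell p.1 p.2].

Lemma measurable_edist_cst n (p : E n) : measurable_fun setT (fun x : E n => edist x p).
Proof. by apply: measurable_edist => //; exact: measurable_cst. Qed.

(** Joint measurability in configuration and point: being outside the cell is a
    countable union of rectangles made of a non-void event and an open set.
    Tonelli's theorem then makes volumes measurable in the configuration. *)
Lemma measurable_cell_graph n : measurable (@cell_graph n).
Proof.
pose b (u : n.-tuple rat * rat) : set (E n) :=
  [set x | edist x (rat_point u.1) < ratr u.2].
pose w (u : n.-tuple rat * rat) : set (E n) :=
  [set y | edist y (rat_point u.1) + ratr u.2 < enorm y].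
have mb u : measurable (b u).
  rewrite -[X in measurable X]setTI (_ : b u =
    (fun x : E n => edist x (rat_point u.1)) @^-1` `]-oo, ratr u.2[).
    by apply: measurable_edist_cst => //; exact: measurable_itv.
  by apply/seteqP; split => x /=; rewrite in_itv.
have mw u : measurable (w u).
  rewrite -[X in measurable X]setTI (_ : w u =
    (fun y : E n => edist y (rat_point u.1) + ratr u.2 - enorm y) @^-1` `]-oo, 0[).
    have mf : measurable_fun setT
        (fun y : E n => edist y (rat_point u.1) + ratr u.2 - enorm y).
      apply: measurable_funB; last exact: measurable_enorm.
      by apply: measurable_funD => //; exact: measurable_edist_cst.
    by apply: mf => //; exact: measurable_itv.
  by apply/seteqP; split => x /=; rewrite in_itv/= subr_lt0.
rewrite (_ : @cell_graph n =
    ~` \bigcup_u ((~` void_event (b u) : set (configuration n)) `*` w u)).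
  apply: measurableC; apply: countable_bigcupT_measurable => [|u]; first exact: countableP.
  by apply: measurableX => //; apply: measurableC; exact: measurable_void_event.
apply/seteqP; split => [[X y] /= /typical_cellP H [u _ /= [Xu yu]]|[X y] /= H].
  by have [/Xu|] := H u.
apply/typical_cellP => u; have [Xu|Xu] := pselect (void_event (b u) X); first by left.
by right=> yu; apply: H; exists u.
Qed.

Lemma measurable_typical_cell n (X : set (E n)) : measurable (typical_cell X).
Proof.
rewrite (_ : typical_cell X = xsection (@cell_graph n) (X : configuration n)).
  by apply: measurable_xsection; exact: measurable_cell_graph.
by apply/seteqP; split => y; rewrite /xsection/= inE.
Qed.

Lemma measurable_cell_volume n (B : set (E n)) : measurable B ->
  measurable_fun setT
    (fun X : configuration n => lebesgue n (B `&` typical_cell X)).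
Proof.
move=> mB; pose M : set (configuration n * E n) := (setT `*` B) `&` @cell_graph n.
have mM : measurable M.
  by apply: measurableI; [exact: measurableX|exact: measurable_cell_graph].
have := measurable_fun_xsection (lebesgue n) mM.
congr measurable_fun; apply/funext => X /=; congr (lebesgue n _).
apply/seteqP; split => y; rewrite /xsection/= inE /M.
  by move=> [[_ By] Xy].
by move=> [By Xy].
Qed.

End configurations.

(** * Uniform points in polar coordinates *)

Section halved_points.
Context {R : realType} (n : nat).
Local Notation mu := (@lebesgue_measure R).
Local Notation mR := (measurableTypeR R).
Local Notation E n := (euclidean R n).
Local Notation coord := (mR * E n.+1)%type.

Lemma polar_pointZ m (c r : mR) (a : E m) :
  @polar_point R m.+1 (c * r) a = escale c (@polar_point R m.+1 r a).
Proof.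
by apply: eq_from_tnth => i; rewrite !tnth_mktuple !mulrA.
Qed.

Lemma enorm_polar_point m (r : mR) (a : E m) :
  enorm (@polar_point R m.+1 r a) = `|r : R|.
Proof.
rewrite -sqrtr_sqr; congr Num.sqrt.
elim: m r a => [|m IH] r a.
  by rewrite polar_point1 big_ord1.
rewrite -(tuple_unconsK a); case: (tuple_uncons a) => t b.
rewrite polar_point_cons big_ord_recl.
under eq_bigr do rewrite tnthS.
by rewrite IH !exprMn -mulrDr cos2Dsin2 mulr1.
Qed.

(** The point of the process represented by the halved polar coordinates u. *)
Definition doubled_point (u : coord) : E n.+2 :=
  @polar_point R n.+2 (2 * (u.1 : R)) u.2.

Lemma measurable_doubled_point : measurable_fun setT doubled_point.
Proof.
by apply: measurable_polar_point => //; exact: measurable_funM.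
Qed.

Definition coord_weight (l : R) (u : coord) : R :=
  \1_(@polar_domain R n.+2 l : set coord) u *
  ((kappa n.+2 * l ^+ n.+2)^-1 * (u.1 : R) ^+ n.+1 * @Delta R n.+2 u.2).

Lemma measurable_polar_domain l : measurable (@polar_domain R n.+2 l : set coord).
Proof.
by apply: measurableX; [exact: measurable_itv|exact: measurable_angle_domain].
Qed.

Lemma measurable_coord_weight l : measurable_fun setT (coord_weight l).
Proof.
apply: measurable_funM.
  by apply: measurable_indic; exact: measurable_polar_domain.
apply: measurable_funM; last exact: measurableT_comp (@measurable_Delta R n.+1) _.
by apply: measurable_funM => //; exact: measurable_funX.
Qed.

Lemma coord_weightE l (u : coord) : coord_weight l u =
  (kappa n.+2 * l ^+ n.+2)^-1 *
  (angle_weight u.2 * (((0 <= (u.1 : R) <= l)%R : nat)%:R * (u.1 : R) ^+ n.+1)).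
Proof.
rewrite /coord_weight /angle_weight.
have -> : \1_(@polar_domain R n.+2 l : set coord) u =
    ((0 <= (u.1 : R) <= l)%R : nat)%:R * \1_(@angle_domain R n.+2 : set (E n.+1)) u.2 :> R.
  rewrite !indicE -natrM mulnb; congr (nat_of_bool _)%:R.
  apply/idP/andP => [/set_mem[/=]|[u1 /set_mem u2]].
    by rewrite in_itv/= => ? ?; split => //; apply/mem_set.
  by apply/mem_set; split => //=; rewrite in_itv.
move: (_ : nat)%:R (\1__ _) (_^-1) (_ ^+ n.+1) (Delta _) => x y c p D.
ring.
Qed.

Lemma coord_weight_ge0 l u : 0 < l -> 0 <= coord_weight l u.
Proof.
move=> l0; rewrite coord_weightE mulr_ge0//.
  by rewrite invr_ge0 mulr_ge0 ?exprn_ge0 ?(ltW l0)// ltW// kappa_gt0.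
rewrite mulr_ge0 ?angle_weight_ge0//.
by have [/andP[? _]|] := boolP (_ <= _ <= _); rewrite ?mul0r// mul1r exprn_ge0.
Qed.

(** The weight is the density, in polar coordinates, of a halved point which is
    uniform in the ball of radius l, so the doubled point is uniform in the ball
    of radius 2 l. *)
Lemma integral_doubled_point l (f : E n.+2 -> \bar R) : 0 < l ->
  measurable_fun setT f -> (forall y, (0 <= f y)%E) ->
  (\int[@polar_measure R n.+2]_u (f (doubled_point u) * (coord_weight l u)%:E) =
   ((kappa n.+2 * (2 * l) ^+ n.+2)^-1)%R%:E *
   \int[lebesgue n.+2]_(y in eball n.+2 (2 * l)%R) f y)%E.
Proof.
move=> l0 mf f0.
pose c : R := (kappa n.+2 * l ^+ n.+2)^-1.
have c0 : 0 <= c by rewrite invr_ge0 mulr_ge0 ?exprn_ge0 ?(ltW l0)// ltW// kappa_gt0.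
pose g (y : E n.+2) : \bar R := (f (escale 2 y) * (\1_(eball n.+2 l) y)%:E)%E.
have mb (r : R) : measurable_fun setT (fun y : E n.+2 => (\1_(eball n.+2 r) y : R)%:E).
  by apply/measurable_EFinP; apply: measurable_indic; exact: measurable_eball.
have mg : measurable_fun setT g.
  apply: emeasurable_funM => //.
  exact: measurableT_comp mf (measurable_escale _).
have g0 y : (0 <= g y)%E by rewrite mule_ge0// lee_fin.
have mF : measurable_fun setT (fun u : coord =>
    f (doubled_point u) * (coord_weight l u)%:E)%E.
  apply: emeasurable_funM; first exact: measurableT_comp mf measurable_doubled_point.
  by apply/measurable_EFinP; exact: measurable_coord_weight.
have F0 u : (0 <= f (doubled_point u) * (coord_weight l u)%:E)%E.
  by rewrite mule_ge0// lee_fin coord_weight_ge0.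
transitivity (c%:E * \int[lebesgue n.+2]_y g y)%E.
  rewrite integral_polar// -ge0_integralZl//; last 2 first.
  - exact: measurable_angular_integral.
  - by move=> a _; exact: angular_integral_ge0.
  transitivity (\int[lebesgue n.+1]_a \int[mu]_r
      (f (doubled_point (r, a)) * (coord_weight l (r, a))%:E))%E.
    exact: (fubini_tonelli2 (m1 := mu) (m2 := lebesgue n.+1) _ mF F0).
  apply: eq_integral => a _; rewrite -ge0_integralZl//; last 2 first.
  - have ma : measurable_fun setT (fun r : mR => (a, r)) by exact: pair1_measurable.
    exact: measurableT_comp (measurable_polar_integrand mg) ma.
  - by move=> r _; exact: polar_integrand_ge0.
  apply: eq_integral => r _; rewrite coord_weightE -/c /polar_integrand /g.
  rewrite /doubled_point/= polar_pointZ.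
  rewrite -[in RHS]muleA [RHS]muleCA -!EFinM; congr (_ * _%:E)%E.
  rewrite indicE mem_eball enorm_polar_point pos_indE.
  have [r0|r0|r0] := ltgtP 0 (r : R); last by rewrite -r0 expr0n/= !mulr0.
    rewrite gtr0_norm//=; move: (_ <= l) => b.
    by move: (angle_weight a) (r ^+ n.+1) => w p; case: b; rewrite /= ?mulr0n ?mulr1n; ring.
  by rewrite /= !(mul0r, mulr0).
have mfb : measurable_fun setT
    (fun y : E n.+2 => f y * (\1_(eball n.+2 (2 * l)) y)%:E)%E.
  exact: emeasurable_funM.
have fb0 y : (0 <= f y * (\1_(eball n.+2 (2 * l)) y)%:E)%E.
  by rewrite mule_ge0// lee_fin.
rewrite [in RHS]integral_mul_indic [in RHS](integral_escale (ltr0n R 2) mfb fb0).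
have mg2 : measurable_fun setT (fun y : E n.+2 =>
    f (escale 2 y) * (\1_(eball n.+2 (2 * l)) (escale 2 y))%:E)%E.
  apply: emeasurable_funM; first exact: measurableT_comp mf (measurable_escale _).
  apply/measurable_EFinP; apply: measurable_indic_comp (@measurable_escale _ _ _).
  exact: measurable_eball.
rewrite [in RHS]ge0_integralZr//.
have <- : (\int[lebesgue n.+2]_y g y = \int[lebesgue n.+2]_x
    (f (escale 2 x) * (\1_(eball n.+2 (2 * l)) (escale 2 x))%:E))%E.
  apply: eq_integral => y _; congr (_ * _%:E)%E.
  by rewrite !indicE !mem_eball enorm_escale// ler_pM2l.
rewrite [X in (_ = _ * X)%E]muleC muleA -EFinM; congr (_%:E * _)%E.
rewrite exprMn /c; field.
by rewrite !gt_eqF ?exprn_gt0 ?kappa_gt0.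
Qed.

End halved_points.

(** * The volume of the cell in polar coordinates *)

Section cell_in_polar_coordinates.
Context {R : realType} (n : nat).
Local Notation mu := (@lebesgue_measure R).
Local Notation mR := (measurableTypeR R).
Local Notation E n := (euclidean R n).
Local Notation coord := (mR * E n.+1)%type.

Lemma edist_escale_sqr m (r : R) (w x : E m) :
  edist (escale r w) x ^+ 2 = r ^+ 2 * enorm w ^+ 2
    - 2 * r * (\sum_(i < m) (tnth w i : R) * (tnth x i : R)) + enorm x ^+ 2.
Proof.
rewrite edistE !enormE !mulr_sumr -sumrB -big_split/=.
by apply: eq_bigr => i _; rewrite tnth_mktuple; ring.
Qed.

(** A ray from the origin meets the bisector hyperplane of 0 and x at most
    once; this is the only radius where the strict and the weak inequality
    differ. *)
Definition bisector_radius (a : E n.+1) (u : coord) : R :=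
  enorm (doubled_point u) ^+ 2 /
  (2 * \sum_(i < n.+2) (tnth (@polar_point R n.+2 1 a) i : R) * (tnth (doubled_point u) i : R)).

Lemma polar_point_unit m (r : mR) (a : E m) :
  @polar_point R m.+1 r a = escale r (@polar_point R m.+1 1 a).
Proof. by rewrite -polar_pointZ mulr1. Qed.

Lemma bisector_radiusP (a : E n.+1) (u : coord) (r : R) : 0 < r -> 0 < (u.1 : R) ->
  edist (@polar_point R n.+2 r a) (doubled_point u) = r -> r = bisector_radius a u.
Proof.
move=> r0 u0 H; have := edist_escale_sqr r (@polar_point R n.+2 1 a) (doubled_point u).
rewrite -polar_point_unit H enorm_polar_point normr1 /bisector_radius.
set D := \sum_(i < _) _; rewrite expr1n mulr1.
have : 0 < enorm (doubled_point u) ^+ 2.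
  by rewrite exprn_gt0// enorm_polar_point normr_gt0 mulf_neq0 ?gt_eqF.
move: (enorm _ ^+ 2) => N N0 E2.
have E3 : N = r * (2 * D) by lra.
have D0 : 2 * D != 0 by apply/eqP => D0; move: N0; rewrite E3 D0 mulr0 ltxx.
by rewrite E3 mulfK.
Qed.

Lemma Dind_weak (a : E n.+1) (u : coord) (r : R) : 0 < r -> 0 < (u.1 : R) ->
  r != bisector_radius a u ->
  @Dind R n.+2 u r a =
  (enorm (@polar_point R n.+2 r a) <=
   edist (doubled_point u) (@polar_point R n.+2 r a))%R%:R.
Proof.
move=> r0 u0 rb; rewrite /Dind enorm_polar_point gtr0_norm// (edistC (doubled_point u)).
have [ur|ur] := leP (u.1 : R) r.
  rewrite lt_neqAle; case: eqP => //= rE.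
  by case/eqP: rb; exact: (bisector_radiusP r0 u0 (esym rE)).
have := enorm_triangle (doubled_point u) (@polar_point R n.+2 r a).
rewrite !enorm_polar_point (gtr0_norm r0) gtr0_norm ?mulr_gt0// edistC => H.
by rewrite (_ : r <= _) ?mulr1n//; move: H ur; move: (u.1 : R) => v; lra.
Qed.

Definition coord_config k (us : k.-tuple coord) : set (E n.+2) :=
  [set x | exists i, x = doubled_point (tnth us i)].

Lemma prod_nat_bool k (P : pred 'I_k) :
  \prod_(i < k) ((P i : nat)%:R : R) = ([forall i, P i] : nat)%:R.
Proof.
have [/forallP H|] := boolP [forall i, P i].
  by rewrite big1// => i _; rewrite H.
by rewrite negb_forall => /existsP[i /negbTE Pi]; rewrite (bigD1 i)//= Pi mul0r.
Qed.

Lemma prod_Dind k (us : k.-tuple coord) (a : E n.+1) (r : R) : 0 < r ->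
  (forall i, 0 < ((tnth us i).1 : R)) ->
  (forall i, r != bisector_radius a (tnth us i)) ->
  \prod_(i < k) @Dind R n.+2 (tnth us i) r a =
  \1_(typical_cell (coord_config us)) (@polar_point R n.+2 r a).
Proof.
move=> r0 us0 rN; rewrite (eq_bigr (fun i =>
    ((enorm (@polar_point R n.+2 r a) <= edist (doubled_point (tnth us i))
       (@polar_point R n.+2 r a))%R : nat)%:R)) => [|i _]; last exact: Dind_weak.
rewrite prod_nat_bool indicE; congr (nat_of_bool _)%:R.
apply/forallP/idP => [H|/set_mem H i]; last by apply: H; exists i.
by apply/mem_set => _ [i ->]; exact: H.
Qed.

Lemma measurable_Dind (a : E n.+1) (u : coord) :
  measurable_fun setT (fun r : mR => @Dind R n.+2 u r a).
Proof.
apply: measurable_fun_ifT.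
- exact: measurable_fun_ler.
- have md : measurable_fun setT (fun r : mR =>
      (r : R) < edist (@polar_point R n.+2 r a) (doubled_point u)).
    apply: measurable_fun_ltr => //; apply: measurable_edist => //.
    exact: measurable_polar_point.
  have := measurable_fun_ifT md (measurable_cst (1 : R)) (measurable_cst (0 : R)).
  by congr measurable_fun; apply/funext => r; rewrite /=; case: (_ < _).
- exact: measurable_cst.
Qed.

Lemma Dind_itv (a : E n.+1) (u : coord) r : 0 <= @Dind R n.+2 u r a <= 1.
Proof. by rewrite /Dind; case: ifP => _; [case: (_ < _)|]; rewrite ?lexx ?ler01. Qed.

(** The functions g_k are iterated integrals of the polar integrand of the
    indicator of the cell, up to finitely many radii on each ray.  Nuclei at the
    origin are excluded: the strict inequality would empty the cell. *)
Lemma g_k_volume k (us : k.-tuple coord) (z : R) : 0 <= z ->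
  (forall i, 0 < ((tnth us i).1 : R)) ->
  (@g_k R n.+2 k z us)%:E =
  lebesgue n.+2 (eball n.+2 z `&` typical_cell (coord_config us)).
Proof.
move=> z0 us0; set A := _ `&` _.
have mA : measurable A.
  by apply: measurableI; [exact: measurable_eball|exact: measurable_typical_cell].
have Afin : lebesgue n.+2 A \is a fin_num.
  rewrite ge0_fin_numE//; apply: (@le_lt_trans _ _ (lebesgue n.+2 (eball n.+2 (z + 1)))).
    apply: le_measure; rewrite ?inE//; first exact: measurable_eball.
    by move=> y [/= yz _]; rewrite /eball/= (le_trans yz)// lerDl.
  by rewrite lebesgue_eball ?ltry// ltr_wpDl.
pose F (a : E n.+1) (r : R) : R :=
  (\prod_(i < k) @Dind R n.+2 (tnth us i) r a) * r ^+ n.+1 * @Delta R n.+2 a.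
pose ind : E n.+2 -> \bar R := fun y => (\1_A y)%:E.
have mind : measurable_fun setT ind.
  by apply/measurable_EFinP; exact: measurable_indic.
have ind0 y : (0 <= ind y)%E by rewrite lee_fin.
have mF a : measurable_fun setT (fun r : mR => F a r).
  apply: measurable_funM => //; apply: measurable_funM; last exact: measurable_funX.
  by apply: measurable_prod => i _; exact: measurable_Dind.
have AWin a : @angle_domain R n.+2 a -> angle_weight a = @Delta R n.+2 a.
  by move=> aD; rewrite /angle_weight indicE mem_set// mul1r.
have AD0 a : @angle_domain R n.+2 a -> 0 <= @Delta R n.+2 a.
  by move=> aD; rewrite -AWin//; exact: angle_weight_ge0.
have P01 a r : 0 <= \prod_(i < k) @Dind R n.+2 (tnth us i) r a <= 1.
  apply/andP; split; first by apply: prodr_ge0 => i _; have /andP[] := Dind_itv a (tnth us i) r.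
  by apply: prodr_ile1 => i _; exact: Dind_itv.
have F0 a r : @angle_domain R n.+2 a -> `[0, z]%classic r -> 0 <= F a r.
  rewrite /= in_itv/= => aD /andP[r0 _]; rewrite mulr_ge0 ?AD0// mulr_ge0 ?exprn_ge0//.
  by have /andP[] := P01 a r.
have Jfin a : @angle_domain R n.+2 a ->
    (\int[mu]_(r in `[0%R, z]) (F a r)%:E)%E \is a fin_num.
  move=> aD; rewrite ge0_fin_numE; last first.
    by apply: integral_ge0 => r rz; rewrite lee_fin F0.
  apply: (@le_lt_trans _ _ (\int[mu]_(r in `[0%R, z]) (cst (z ^+ n.+1 * @Delta R n.+2 a)%:E r))%E).
    apply: ge0_le_integral => //.
    - by move=> r rz; rewrite lee_fin F0.
    - by apply/measurable_EFinP/measurable_funTS; exact: mF.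
    - move=> r /=; rewrite in_itv/= => /andP[r0 rz]; rewrite lee_fin.
      apply: ler_wpM2r; first exact: AD0.
      have /andP[p0 p1] := P01 a r.
      rewrite -[leRHS]mul1r; apply: ler_pM => //; first exact: exprn_ge0.
      by rewrite lerXn2r// nnegrE.
  rewrite integral_cst//= lebesgue_measure_itv/=.
  by case: ifP => _; rewrite -?EFinB -?EFinM ?mule0 ltry.
have JE a : @angle_domain R n.+2 a ->
    (\int[mu]_(r in `[0%R, z]) (F a r)%:E = \int[mu]_r polar_integrand ind a r)%E.
  move=> aD; rewrite integral_mul_indic.
  have ma : measurable_fun setT (fun r : mR => (a, r)) by exact: pair1_measurable.
  apply: (@eq_integral_off_finite R
    ([set 0] `|` [set bisector_radius a (tnth us i) | i in [set: 'I_k]])).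
  - rewrite finite_setU; split; first exact: finite_set1.
    exact/finite_image/finite_finset.
  - apply: emeasurable_funM; first by apply/measurable_EFinP; exact: mF.
    by apply/measurable_EFinP; apply: measurable_indic; exact: measurable_itv.
  - exact: measurableT_comp (measurable_polar_integrand mind) ma.
  - move=> r; rewrite indicE; have [/set_mem rz|_] := boolP (_ \in _).
      by rewrite mule1 lee_fin F0.
    by rewrite mule0.
  - by move=> r; exact: polar_integrand_ge0.
  move=> r Nr; rewrite /polar_integrand /ind -!EFinM; congr (_%:E).
  rewrite AWin// pos_indE indicE mem_setE in_itv/=.
  have [r0|r0|r0] := ltgtP 0 (r : R); last by exfalso; apply: Nr; left.
    rewrite /F prod_Dind//; last first.
      by move=> i; apply/eqP => rE; apply: Nr; right; exists i.
    rewrite !indicE in_setI mem_eball enorm_polar_point gtr0_norm//=.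
    rewrite -mulnb natrM mul1r; ring.
  by rewrite /= !(mul0r, mulr0).
rewrite -[RHS]fineK//; congr (_%:E).
rewrite -[in RHS](integral_indicT _ mA) integral_polar// /g_k /Rintegral.
congr fine.
rewrite integral_mul_indic; apply: eq_integral => a _.
rewrite indicE; have [/set_mem aD|aD] := boolP (_ \in _).
  by rewrite mule1 fineK; [exact: JE|exact: Jfin].
rewrite mule0 integral0_eq// => r _; rewrite /polar_integrand.
have -> : angle_weight a = 0 by rewrite /angle_weight indicE (negbTE aD) mul0r.
by rewrite mul0r mule0.
Qed.

End cell_in_polar_coordinates.

(** * The law given the number of points *)

Section conditional_law.
Context {R : realType} (n : nat).
Local Notation mu := (@lebesgue_measure R).
Local Notation mR := (measurableTypeR R).
Local Notation E n := (euclidean R n).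
Local Notation coord := (mR * E n.+1)%type.
Local Notation pm := (@polar_measure R n.+2).

Lemma measurable_coord_config k :
  measurable_fun setT (@coord_config R n k : k.-tuple coord -> configuration n.+2).
Proof.
apply: measurable_to_configuration => A mA.
rewrite (_ : _ @^-1` _ = \bigcap_(i in [set: 'I_k])
    ((fun us : k.-tuple coord => doubled_point (tnth us i)) @^-1` (~` A))).
  apply: fin_bigcap_measurable => [|i _]; first exact: finite_finset.
  rewrite -[X in measurable X]setTI.
  have mi : measurable_fun setT (fun us : k.-tuple coord => doubled_point (tnth us i)).
    exact: measurableT_comp (@measurable_doubled_point _ _) (measurable_tnth (T := coord) i).
  by apply: mi => //; exact: measurableC.
apply/seteqP; split => us /=.
  by move=> H i _ /= Ai; have : set0 (doubled_point (tnth us i)) by rewrite -H; split=> //; exists i.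
by move=> H; apply/seteqP; split => // x [[i ->] Ai]; exact: (H i I Ai).
Qed.

Definition config_weight (l : R) k (us : k.-tuple coord) : R :=
  \prod_(i < k) coord_weight l (tnth us i).

Lemma measurable_config_weight l k : measurable_fun setT (@config_weight l k).
Proof.
apply: measurable_prod => i _.
exact: measurableT_comp (@measurable_coord_weight _ _ l) (measurable_tnth (T := coord) i).
Qed.

Lemma config_weight_ge0 l (l0 : 0 < l) k (us : k.-tuple coord) : 0 <= config_weight l us.
Proof. by apply: prodr_ge0 => i _; exact: coord_weight_ge0. Qed.

(** The law of k independent uniform points in the ball of radius 2 l, given by
    the polar coordinates of the halved points. *)
Definition conditional_law (l : R) (l0 : 0 < l) k :
    {measure set (configuration n.+2) -> \bar R} :=
  weighted_pushforward (tuple_measure pm k) (@measurable_coord_config k)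
    (@measurable_config_weight l k) (@config_weight_ge0 l l0 k).

(** By independence the integral over k-tuples is a product over the points. *)
Lemma conditional_law_void (l : R) (l0 : 0 < l) k (A : set (E n.+2)) : measurable A ->
  conditional_law l0 k (void_event A) =
  ((fine (lebesgue n.+2 (eball n.+2 (2 * l) `\` A)) /
    (kappa n.+2 * (2 * l) ^+ n.+2)) ^+ k)%:E.
Proof.
move=> mA; pose B := eball n.+2 (2 * l) `\` A.
have l20 : 0 < 2 * l by rewrite mulr_gt0.
have mB : measurable B by apply: measurableD => //; exact: measurable_eball.
have Bfin : lebesgue n.+2 B \is a fin_num.
  rewrite ge0_fin_numE//; apply: (@le_lt_trans _ _ (lebesgue n.+2 (eball n.+2 (2 * l)))).
    apply: le_measure; rewrite ?inE//; first exact: measurable_eball.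
    exact: subDsetl.
  by rewrite lebesgue_eball ?ltry.
pose h (u : coord) : R := \1_(~` A) (doubled_point u) * coord_weight l u.
have mnA := measurableC mA.
have mh : measurable_fun setT h.
  apply: measurable_funM; last exact: measurable_coord_weight.
  exact: measurable_indic_comp (@measurable_doubled_point _ _).
have h0 u : 0 <= h u by rewrite mulr_ge0// coord_weight_ge0.
transitivity (\int[tuple_measure pm k]_us (\prod_(i < k) h (tnth us i))%:E)%E.
  rewrite /conditional_law/= /weighted_pushforward integral_mul_indic; apply: eq_integral => us _.
  rewrite big_split/= -EFinM mulrC; congr (_ * _)%:E.
  under eq_bigr do rewrite indicE.
  rewrite prod_nat_bool indicE; congr (nat_of_bool _)%:R.
  apply/idP/forallP => [/set_mem H i|H].
    apply/mem_set => Ai; have : set0 (doubled_point (tnth us i)) by rewrite -H; split => //; exists i.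
    by [].
  apply/mem_set; apply/seteqP; split => // x [[i ->] Ai].
  by have /set_mem := H i.
rewrite integral_tuple_prod// EFin_expe; congr (_ ^+ _)%E.
rewrite (eq_integral (fun u : coord => (\1_(~` A) (doubled_point u))%:E * (coord_weight l u)%:E)%E)//.
rewrite (integral_doubled_point (f := fun x => (\1_(~` A) x)%:E))//; last first.
  by apply/measurable_EFinP; exact: measurable_indic.
rewrite integral_indic//; last exact: measurable_eball.
have -> : ~` A `&` eball n.+2 (2 * l) = B by rewrite setIC -setDE.
by rewrite [RHS]EFinM (fineK Bfin) muleC.
Qed.

Lemma conditional_law_setT (l : R) (l0 : 0 < l) k : conditional_law l0 k setT = 1%E.
Proof.
rewrite -(@void_event0 _ n.+2) conditional_law_void// setD0.
rewrite lebesgue_eball ?mulr_gt0//= divff ?expr1n//.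
by rewrite gt_eqF// mulr_gt0 ?kappa_gt0// exprn_gt0// mulr_gt0.
Qed.

(** The probability that a uniform point of the part of the cell in the ball of
    radius l is at distance at most z from the origin. *)
Definition cell_ratio (z l : R) (X : configuration n.+2) : R :=
  fine (lebesgue n.+2 (eball n.+2 z `&` typical_cell X)) /
  fine (lebesgue n.+2 (eball n.+2 l `&` typical_cell X)).

Lemma measurable_cell_ratio z l : measurable_fun setT (cell_ratio z l).
Proof.
have mfine (r : R) : measurable_fun setT (fun X : configuration n.+2 =>
    fine (lebesgue n.+2 (eball n.+2 r `&` typical_cell X))).
  apply: measurableT_comp; first exact: fine_measurable.
  by apply: measurable_cell_volume; exact: measurable_eball.
apply: measurable_funM => //.
exact: measurableT_comp measurable_invr (mfine l).
Qed.

Lemma cell_part_fin_num (z : R) (X : set (E n.+2)) :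
  lebesgue n.+2 (eball n.+2 z `&` typical_cell X) \is a fin_num.
Proof.
rewrite ge0_fin_numE//.
apply: (@le_lt_trans _ _ (lebesgue n.+2 (eball n.+2 (`|z| + 1)))).
  apply: le_measure; rewrite ?inE//.
  - apply: measurableI; first exact: measurable_eball.
    exact: measurable_typical_cell.
  - exact: measurable_eball.
  move=> y [/= yz _]; rewrite /eball/= (le_trans yz)//.
  by rewrite (le_trans (ler_norm z))// lerDl.
by rewrite lebesgue_eball ?ltry// ltr_wpDl.
Qed.

Lemma cell_part_le (z l : R) (X : set (E n.+2)) : z <= l ->
  (lebesgue n.+2 (eball n.+2 z `&` typical_cell X) <=
   lebesgue n.+2 (eball n.+2 l `&` typical_cell X))%E.
Proof.
move=> zl; apply: le_measure; rewrite ?inE//.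
- by apply: measurableI; [exact: measurable_eball|exact: measurable_typical_cell].
- by apply: measurableI; [exact: measurable_eball|exact: measurable_typical_cell].
by move=> y [/= yz Xy]; split => //=; exact: le_trans zl.
Qed.

Lemma ratio_itv (a b : R) : 0 <= a -> a <= b -> 0 <= a / b <= 1.
Proof.
move=> a0 ab; have b0 := le_trans a0 ab; rewrite divr_ge0//=.
have [->|bN0] := eqVneq b 0; first by rewrite invr0 mulr0.
by rewrite ler_pdivrMr ?mul1r// lt_def bN0.
Qed.

Lemma cell_ratio_itv (z l : R) X : z <= l -> 0 <= cell_ratio z l X <= 1.
Proof.
move=> zl; apply: ratio_itv; first exact: fine_ge0.
by apply: fine_le; [exact: cell_part_fin_num|exact: cell_part_fin_num|exact: cell_part_le].
Qed.

(** When every halved point is off the origin, the integrand is the ratio of two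
    volumes; when one is at the origin, its weight is zero. *)
Lemma F_Rl_conditional_law (z l : R) (l0 : 0 < l) k : 0 <= z -> z <= l ->
  ((@F_Rl R n.+2 l z k)%:E = \int[conditional_law l0 k]_X (cell_ratio z l X)%:E)%E.
Proof.
move=> z0 zl.
have f0 X : (0 <= (cell_ratio z l X)%:E)%E.
  by rewrite lee_fin; have /andP[] := cell_ratio_itv X zl.
have mf : measurable_fun setT (fun X => (cell_ratio z l X)%:E).
  by apply/measurable_EFinP; exact: measurable_cell_ratio.
have fin : (\int[conditional_law l0 k]_X (cell_ratio z l X)%:E)%E \is a fin_num.
  rewrite ge0_fin_numE ?integral_ge0//.
  apply: (@le_lt_trans _ _ (\int[conditional_law l0 k]_X cst 1%E X)%E).
    apply: ge0_le_integral => //.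
    by move=> X _; rewrite lee_fin; have /andP[] := cell_ratio_itv X zl.
  by rewrite integral_cst// mul1e conditional_law_setT ltry.
rewrite -[RHS]fineK//; congr (_%:E); rewrite /F_Rl /Rintegral; congr fine.
rewrite [RHS]integral_weighted_pushforward// integral_mkcond; apply: eq_integral => us _.
rewrite patchE -EFinM; case: ifPn => [/set_mem/= us_dom|us_dom]; last first.
  have : ~ (forall i, @polar_domain R n.+2 l (tnth us i)).
    by move=> H; move: us_dom; rewrite mem_set.
  move=> /existsNP[i ui].
  have w0 : coord_weight l (tnth us i) = 0.
    by rewrite /coord_weight indicE memNset// mul0r.
  by rewrite /config_weight (bigD1 i)//= w0 mul0r mulr0.
congr (_%:E).
have wE : config_weight l us = \prod_(i < k) ((kappa n.+2 * l ^+ n.+2)^-1 *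
   ((tnth us i).1 : R) ^+ n.+1 * @Delta R n.+2 (tnth us i).2).
  by apply: eq_bigr => i _; rewrite /coord_weight indicE mem_set ?mul1r.
rewrite wE; have [us0|] := pselect (forall i, 0 < ((tnth us i).1 : R)).
  congr (_ * _); rewrite /cell_ratio.
  by rewrite -!g_k_volume// (le_trans z0).
move=> /existsNP[i /negP]; rewrite -leNgt => ui.
have u0 : ((tnth us i).1 : R) = 0.
  have [/=] := us_dom i; rewrite in_itv/= => /andP[ui0 _] _.
  by apply/eqP; rewrite eq_le ui.
by rewrite (bigD1 i)//= u0 expr0n/= mulr0 !mul0r !mulr0.
Qed.

End conditional_law.

Arguments conditional_law {R n l} l0 k.
Arguments F_Rl_conditional_law {R n z l} l0 k.

(** * The Poisson process in a ball *)

Section poisson_mixture.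
Context {R : realType} {dO : measure_display} {Omega : measurableType dO}.
Context (P : probability Omega R) (n : nat) (lambda : R).
Local Notation E n := (euclidean R n).
Variable Phi : Omega -> set (E n.+2).
Hypotheses (lambda0 : 0 < lambda) (hPhi : poisson_process P lambda Phi).

Lemma nneseries_expR (x : R) :
  (\sum_(k <oo) (x ^+ k / k`!%:R)%:E = (expR x)%:E :> \bar R)%E.
Proof.
rewrite expRE -EFin_lim; last first.
  rewrite /pseries/=; under eq_fun do rewrite mulrC.
  exact: is_cvg_series_exp_coeff.
apply/congr_lim/funext => m/=; rewrite /pseries/= /series/= -sumEFin//.
by under [RHS]eq_bigr do rewrite mulrC.
Qed.

Lemma poisson_prob_set1 (r : R) k : 0 < r ->
  poisson_prob r 0 [set k] = (poisson_pmf r k)%:E.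
Proof.
by move=> r0; rewrite /poisson_prob r0 esum_set1// lee_fin poisson_pmf_ge0.
Qed.

Lemma poisson_prob_void (r : R) : 0 <= r -> poisson_prob r 0 [set 0%N] = (expR (- r))%:E.
Proof.
rewrite le_eqVlt => /predU1P[<-|r0]; last first.
  by rewrite poisson_prob_set1// /poisson_pmf r0 expr0 mul1r fact0 invr1 mul1r.
by rewrite /poisson_prob ltxx oppr0 expR0 diracE mem_set.
Qed.

Lemma npoints_eq0 (A : set (E n.+2)) (w : Omega) :
  npoints_eq Phi A 0 w <-> Phi w `&` A = set0.
Proof.
rewrite /npoints_eq/= /npoints; split => [|->]; last first.
  by rewrite /counting asboolT ?fset_set0.
rewrite /counting; case: asboolP => // fX [] /eqP.
rewrite pnatr_eq0 => /eqP/finmap.cardfs0_eq X0.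
by rewrite -(fset_setK fX) X0 set_fset0.
Qed.

Lemma measurable_npoints_eq A k : measurable A -> measurable (npoints_eq Phi A k).
Proof.
move=> mA; rewrite -[X in measurable X]setTI.
rewrite (_ : npoints_eq Phi A k = npoints Phi A @^-1` [set k%:R%:E])//.
by apply: (pp_measurable hPhi) => //; exact: emeasurable_set1.
Qed.

Definition ball_config (l : R) (w : Omega) : configuration n.+2 :=
  Phi w `&` eball n.+2 (2 * l).

Lemma ball_config_void l A :
  ball_config l @^-1` void_event A = npoints_eq Phi (eball n.+2 (2 * l) `&` A) 0.
Proof.
apply/seteqP; split => w /=.
  by rewrite /void_event/= /ball_config -setIA => H; apply/npoints_eq0.
by move/npoints_eq0; rewrite /void_event/= /ball_config -setIA.
Qed.

Lemma measurable_ball_config l : measurable_fun setT (ball_config l).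
Proof.
apply: measurable_to_configuration => A mA; rewrite ball_config_void.
by apply: measurable_npoints_eq; apply: measurableI => //; exact: measurable_eball.
Qed.

Lemma measurable_Phi : measurable_fun setT (Phi : Omega -> configuration n.+2).
Proof.
apply: measurable_to_configuration => A mA.
rewrite (_ : _ @^-1` _ = npoints_eq Phi A 0); first exact: measurable_npoints_eq.
by apply/seteqP; split => w /=; [move=> H; exact/npoints_eq0|move/npoints_eq0].
Qed.

Lemma lebesgue_ball_part_fin_num (l : R) (A : set (E n.+2)) : 0 < l -> measurable A ->
  lebesgue n.+2 (eball n.+2 l `&` A) \is a fin_num.
Proof.
move=> l0 mA; rewrite ge0_fin_numE//.
apply: (@le_lt_trans _ _ (lebesgue n.+2 (eball n.+2 l))).
  apply: le_measure; rewrite ?inE//; last exact: measurable_eball.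
  by apply: measurableI => //; exact: measurable_eball.
by rewrite lebesgue_eball ?ltry.
Qed.

Lemma lebesgue_ball_split (l : R) (A : set (E n.+2)) : 0 < l -> measurable A ->
  fine (lebesgue n.+2 (eball n.+2 l `&` A)) =
  kappa n.+2 * l ^+ n.+2 - fine (lebesgue n.+2 (eball n.+2 l `\` A)).
Proof.
move=> l0 mA; have fA := lebesgue_ball_part_fin_num l0 mA.
have fD : lebesgue n.+2 (eball n.+2 l `\` A) \is a fin_num.
  by rewrite setDE; apply: lebesgue_ball_part_fin_num => //; exact: measurableC.
have DE : ((kappa n.+2 * l ^+ n.+2)%:E = lebesgue n.+2 (eball n.+2 l `\` A) +
    lebesgue n.+2 (eball n.+2 l `&` A) :> \bar R)%E.
  rewrite -(lebesgue_eball _ l0); apply: measureDI => //.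
  exact: measurable_eball.
move: DE fA fD; move: (lebesgue _ _) (lebesgue _ _) => u v.
case: u => // u; case: v => // v; rewrite -EFinD => -[->] _ _ /=.
by rewrite addrAC subrr add0r.
Qed.

Lemma void_probability (l : R) (A : set (E n.+2)) : 0 < l -> measurable A ->
  P (npoints_eq Phi (eball n.+2 l `&` A) 0) =
  (expR (- (lambda * fine (lebesgue n.+2 (eball n.+2 l `&` A)))))%:E.
Proof.
move=> l0 mA; rewrite (pp_poisson hPhi); last 2 first.
- by apply: measurableI => //; exact: measurable_eball.
- by rewrite -ge0_fin_numE//; exact: lebesgue_ball_part_fin_num.
by rewrite poisson_prob_void// mulr_ge0 ?fine_ge0// ltW.
Qed.

Definition mean_number (l : R) : R := lambda * (kappa n.+2 * (2 * l) ^+ n.+2).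

Lemma mean_number_gt0 l : 0 < l -> 0 < mean_number l.
Proof.
by move=> l0; rewrite mulr_gt0// mulr_gt0 ?kappa_gt0// exprn_gt0// mulr_gt0.
Qed.

Lemma number_law l k : 0 < l ->
  P (npoints_eq Phi (eball n.+2 (2 * l)) k) = (poisson_pmf (mean_number l) k)%:E.
Proof.
move=> l0; have l20 : 0 < 2 * l by rewrite mulr_gt0.
rewrite (pp_poisson hPhi); last 2 first.
- exact: measurable_eball.
- by rewrite lebesgue_eball ?ltry.
by rewrite lebesgue_eball//= poisson_prob_set1//; exact: mean_number_gt0.
Qed.

(** Under both laws on configurations a set A contains no point with probability
    exp(- lambda |B cap A|), where B is the ball; for the mixture this is an
    exponential series. *)
Lemma ball_config_law (l : R) (l0 : 0 < l) (f : configuration n.+2 -> \bar R) :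
  measurable_fun setT f -> (forall X, (0 <= f X)%E) ->
  (\int[P]_w f (ball_config l w) =
   \sum_(k <oo) ((poisson_pmf (mean_number l) k)%:E *
                 \int[conditional_law l0 k]_X f X))%E.
Proof.
move=> mf f0.
(* density 1 makes m1 the law of the process in the ball *)
pose m1 : {measure set (configuration n.+2) -> \bar R} :=
  weighted_pushforward P (measurable_ball_config l) (measurable_cst (1 : R)) (fun=> ler01).
pose m2k k : {measure set (configuration n.+2) -> \bar R} :=
  mscale (NngNum (poisson_pmf_ge0 (mean_number l) k)) (conditional_law l0 k).
pose m2 : {measure set (configuration n.+2) -> \bar R} := mseries m2k 0.
have l20 : 0 < 2 * l by rewrite mulr_gt0.
have m1E S : measurable S -> m1 S = P (ball_config l @^-1` S).
  move=> mS; have mpre : measurable (ball_config l @^-1` S).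
    by rewrite -[X in measurable X]setTI; exact: measurable_ball_config.
  by rewrite -[RHS]mul1e -(integral_cst P mpre).
have m12 S : measurable S -> m1 S = m2 S.
  apply: eq_void_probability => [|A mA].
    by rewrite (m1E _ measurableT) preimage_setT probability_setT ltry.
  pose L := mean_number l; pose K := kappa n.+2 * (2 * l) ^+ n.+2.
  pose D := fine (lebesgue n.+2 (eball n.+2 (2 * l) `\` A)).
  have K0 : 0 < K by rewrite mulr_gt0 ?kappa_gt0// exprn_gt0.
  have D0 : 0 <= D by exact: fine_ge0.
  have L0 : 0 < L by exact: mean_number_gt0.
  have LDK0 : 0 <= L * (D / K) by rewrite mulr_ge0 ?(ltW L0)// divr_ge0// ltW.
  have -> : m1 (void_event A) = (expR (- (lambda * (K - D))))%:E.
    rewrite (m1E _ (measurable_void_event mA)) ball_config_void.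
    by rewrite (void_probability l20 mA) (lebesgue_ball_split l20 mA).
  have -> : m2 (void_event A) =
      (\sum_(k <oo) (poisson_pmf L k * (D / K) ^+ k)%:E)%E.
    apply: eq_eseriesr => k _; rewrite EFinM.
    by rewrite -(conditional_law_void l0 k mA).
  transitivity (\sum_(0 <= k <oo) ((expR (- L))%:E * ((L * (D / K)) ^+ k / k`!%:R)%:E))%E.
    rewrite nneseriesZl; last first.
      by move=> k _; rewrite lee_fin divr_ge0// exprn_ge0.
    rewrite nneseries_expR -EFinM -expRD; congr (expR _)%:E.
    by rewrite /L /mean_number -/K; field; rewrite gt_eqF.
  apply: eq_eseriesr => k _; rewrite -EFinM; congr (_%:E).
  by rewrite /poisson_pmf L0 exprMn; ring.
transitivity (\int[m1]_X f X)%E.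
  rewrite /m1 integral_weighted_pushforward//; apply: eq_integral => w _; by rewrite mule1.
transitivity (\int[m2]_X f X)%E; first by apply: eq_measure_integral => S mS _; exact: m12.
rewrite /m2 ge0_integral_measure_series//; apply: eq_eseriesr => k _.
by rewrite /m2k ge0_integral_mscale.
Qed.

(** A nucleus farther than 2 l cannot capture a point of the ball of radius l. *)
Lemma cell_ratio_ball_config (z l : R) (w : Omega) : z <= l ->
  cell_ratio z l (ball_config l w) = cell_ratio z l (Phi w).
Proof.
move=> zl; have H (r : R) : r <= l ->
    eball n.+2 r `&` typical_cell (ball_config l w) =
    eball n.+2 r `&` typical_cell (Phi w).
  move=> rl; apply/seteqP; split => y [yr Vy]; split => // x Xx; last first.
    by apply: Vy; case: Xx.
  have [xl|lx] := leP (enorm x) (2 * l); first by apply: Vy; split.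
  have := enorm_triangle x y; move: yr; rewrite /eball/= => yr.
  move: (enorm x) (enorm y) (edist x y) lx yr => a b c; lra.
by rewrite /cell_ratio !H.
Qed.

Lemma mixture_expectation (z l : R) : 0 <= z -> 0 < l -> z <= l ->
  (\sum_(0 <= k <oo)
     (@F_Rl R n.+2 l z k)%:E * P (npoints_eq Phi (eball n.+2 (2 * l)) k) =
   \int[P]_w (cell_ratio z l (Phi w))%:E)%E.
Proof.
move=> z0 l0 zl.
transitivity (\int[P]_w (cell_ratio z l (ball_config l w))%:E)%E; last first.
  by apply: eq_integral => w _; rewrite cell_ratio_ball_config.
rewrite (ball_config_law l0 (f := fun X => (cell_ratio z l X)%:E)); last 2 first.
- by apply/measurable_EFinP; exact: measurable_cell_ratio.
- by move=> X; rewrite lee_fin; have /andP[] := cell_ratio_itv X zl.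
by apply: eq_eseriesr => k _; rewrite number_law// (F_Rl_conditional_law l0 k z0 zl) muleC.
Qed.

End poisson_mixture.

(** * The limit of large balls *)

Section limit.
Context {R : realType} (n : nat).
Local Notation E n := (euclidean R n).
Implicit Types X : set (E n.+2).

Definition locally_finite X := forall r, finite_set (X `&` eball n.+2 r).

(** Finitely many nuclei lie in the unit ball, so those different from the origin
    keep a positive distance from it, and a nucleus at the origin cuts nothing
    off the cell. *)
Lemma ball_in_typical_cell X : locally_finite X ->
  exists2 e : R, 0 < e & eball n.+2 e `<=` typical_cell X.
Proof.
move=> lfX; have [s sE] := (finite_seqP _).1 (lfX 1).
have [e e0 es] : exists2 e : R, 0 < e &
    forall x, x \in s -> enorm x = 0 \/ 2 * e <= enorm x.
  elim: s {sE} => [|x s [e e0 IH]]; first by exists 1.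
  have [x0|xN0] := eqVneq (enorm x) 0.
    exists e => // y; rewrite inE => /predU1P[->|]; [by left|exact: IH].
  have xp : 0 < enorm x by rewrite lt_def xN0 enorm_ge0.
  exists (Num.min e (enorm x / 2)); first by rewrite lt_min e0 divr_gt0.
  have h2 (c : R) : e <= c -> 2 * Num.min e (enorm x / 2) <= 2 * c.
    by move=> ec; rewrite ler_pM2l// ge_min ec.
  move=> y; rewrite inE => /predU1P[->|/IH[->|ey]]; [right|by left|right].
    have : Num.min e (enorm x / 2) <= enorm x / 2 by rewrite ge_min lexx orbT.
    lra.
  exact: le_trans (h2 _ (lexx e)) ey.
have m1 : Num.min e (2^-1) <= e by rewrite ge_min lexx.
have m2 : Num.min e (2^-1 : R) <= 2^-1 by rewrite ge_min lexx orbT.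
exists (Num.min e 2^-1); first by rewrite lt_min e0 invr_gt0 ltr0n.
move: (Num.min e _) m1 m2 => c c1 c2 y /= yc x Xx.
have tri := enorm_triangle x y; have tri' := enorm_triangle y x.
rewrite edistC in tri'.
have yc' : enorm y <= c := yc.
have [x1|x1] := leP (enorm x) 1; last first.
  by move: (enorm x) (enorm y) (edist x y) x1 tri tri' yc' => p q r; lra.
have xs : x \in s.
  by have : (X `&` eball n.+2 1) x by []; rewrite sE.
have [x0|ex] := es x xs; first by rewrite x0 addr0 in tri'.
move: (enorm x) (enorm y) (edist x y) ex tri yc' => p q r; lra.
Qed.

Lemma lebesgue_typical_cell_gt0 X : locally_finite X ->
  (0 < lebesgue n.+2 (typical_cell X))%E.
Proof.
move=> /ball_in_typical_cell[e e0 eX].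
apply: (@lt_le_trans _ _ (lebesgue n.+2 (eball n.+2 e))).
  by rewrite lebesgue_eball// lte_fin mulr_gt0 ?kappa_gt0// exprn_gt0.
by apply: le_measure; rewrite ?inE//;
  [exact: measurable_eball|exact: measurable_typical_cell].
Qed.

(** A monotone function has a limit at infinity, which is determined along the
    integers by continuity of the measure from below. *)
Lemma cvg_cell_part X :
  lebesgue n.+2 (eball n.+2 l `&` typical_cell X) @[l --> +oo] -->
  lebesgue n.+2 (typical_cell X).
Proof.
pose b (l : R) := lebesgue n.+2 (eball n.+2 l `&` typical_cell X).
have mb l : measurable (eball n.+2 l `&` typical_cell X).
  by apply: measurableI; [exact: measurable_eball|exact: measurable_typical_cell].
have nd : {homo b : x y / x <= y >-> (x <= y)%E} by move=> x y; exact: cell_part_le.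
have cb := nondecreasing_cvge nd.
suff -> : lebesgue n.+2 (typical_cell X) = ereal_sup (range b) by exact: cb.
apply/eqP; rewrite eq_le; apply/andP; split; last first.
  apply: ge_ereal_sup => _ [l _ <-]; apply: le_measure; rewrite ?inE//.
  exact: measurable_typical_cell.
pose F (m : nat) := eball n.+2 m%:R `&` typical_cell X.
have UF : \bigcup_m F m = typical_cell X.
  apply/seteqP; split => [y [m _ []]//|y Xy].
  exists (Num.bound (enorm y)) => //; split => //=.
  by apply: ltW; apply: archi_boundP; exact: enorm_ge0.
have ndF : {homo F : p q / (p <= q)%N >-> (p <= q)%O}.
  move=> p q pq; apply/subsetPset => y [/= yp Xy]; split => //.
  by rewrite /eball/= (le_trans yp)// ler_nat.
have mUF : measurable (\bigcup_m F m) by rewrite UF; exact: measurable_typical_cell.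
have := @nondecreasing_cvg_mu _ _ R (lebesgue n.+2) F (fun m => mb m%:R) mUF ndF.
rewrite UF => cF; rewrite -(cvg_lim _ cF)//.
apply: lime_le; first by apply/cvg_ex; eexists; exact: cF.
by apply: nearW => m; apply: ereal_sup_ubound; exists m%:R.
Qed.

(** When V is infinite, the quotient on the right is 0 by convention, which is
    the limit. *)
Lemma cvg_ratio (a : R) (b : R -> \bar R) (V : \bar R) :
  (forall l, b l \is a fin_num) -> (0 < V)%E -> b l @[l --> +oo] --> V ->
  (a / fine (b l))%:E @[l --> +oo] --> (a%:E / V)%E.
Proof.
move=> bfin; case: V => [v| |]// V0 cb; last first.
  rewrite invey mule0; apply: cvg_EFin; first exact: nearW.
  rewrite -[X in _ --> X](mulr0 a); apply: cvgMr.
  apply/gtr0_cvgV0; last first.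
    apply/cvgeryP; apply: cvg_trans cb; apply: near_eq_cvg.
    by apply: nearW => l; rewrite fineK.
  have H := (cvgeyPgt b).1 cb 0.
  near=> l; rewrite -lte_fin fineK; last exact: bfin.
  by near: l; exact: H.
rewrite inver gt_eqF// -EFinM; apply: cvg_EFin; first exact: nearW.
apply: cvgMr; apply: cvgV; first by rewrite gt_eqF.
exact: fine_cvg cb.
Unshelve. all: by end_near. Qed.

Lemma cvg_cell_ratio (z : R) X : locally_finite X ->
  (cell_ratio z l (X : configuration n.+2))%:E @[l --> +oo] -->
  uniform_law (typical_cell X) (eball n.+2 z).
Proof.
move=> lfX; have V0 := lebesgue_typical_cell_gt0 lfX; have cb := @cvg_cell_part X.
have := @cvg_ratio (fine (lebesgue n.+2 (eball n.+2 z `&` typical_cell X)))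
  (fun l => lebesgue n.+2 (eball n.+2 l `&` typical_cell X)) _
  (fun l => cell_part_fin_num l X) V0 cb.
by rewrite (fineK (cell_part_fin_num z X)).
Qed.

End limit.

Section expectation_limit.
Context {R : realType} {dO : measure_display} {Omega : measurableType dO}.
Context (P : probability Omega R) (n : nat) (lambda : R).
Local Notation E n := (euclidean R n).
Variable Phi : Omega -> set (E n.+2).
Hypothesis hPhi : poisson_process P lambda Phi.

Lemma cvg_expectation_cell_ratio (z : R) (v : R^nat) : (forall m, z <= v m) ->
  v m @[m --> \oo] --> +oo ->
  (\int[P]_w (cell_ratio z (v m) (Phi w : configuration n.+2))%:E)%E @[m --> \oo] -->
  (\int[P]_w uniform_law (typical_cell (Phi w)) (eball n.+2 z))%E.
Proof.
move=> zv voo; apply: (@dominated_cvg _ _ _ P setT measurableT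
  (fun m w => (cell_ratio z (v m) (Phi w : configuration n.+2))%:E) _ (cst 1%:E)) => //.
- move=> m; apply/measurable_EFinP.
  exact: measurableT_comp (@measurable_cell_ratio R n z (v m)) (measurable_Phi hPhi).
- move=> w _.
  exact: cvg_comp voo (@cvg_cell_ratio R n z _ (pp_locally_finite hPhi w)).
- exact: finite_measure_integrable_cst.
- move=> m w _; have /andP[c0 c1] := cell_ratio_itv (Phi w : configuration n.+2) (zv m).
  by rewrite gee0_abs lee_fin.
Qed.

Lemma cdf_distance_to_nucleus (Y : {RV P >-> E n.+2}) (z : R) :
  cond_uniform_on_cell P Phi Y ->
  cdf (distance_to_nucleus Y) z =
  (\int[P]_w uniform_law (typical_cell (Phi w)) (eball n.+2 z))%E.
Proof.
move=> hY.
have sT : sigma_process Phi setT.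
  exact: (@measurableT _ (g_sigma_algebraType _)).
rewrite -(hY _ _ sT (@measurable_eball R n.+2 z)) setTI; congr (P _).
Qed.

End expectation_limit.

Theorem theorem2 (R : realType) (dO : measure_display)
    (Omega : measurableType dO) (P : probability Omega R)
    (d : nat) (lambda : R) (Phi : Omega -> set (euclidean R d))
    (Y : {RV P >-> euclidean R d}) (z : R) :
  (2 <= d)%N -> 0 < lambda ->
  poisson_process P lambda Phi ->
  cond_uniform_on_cell P Phi Y ->
  0 <= z ->
  (\sum_(0 <= k <oo)
      (F_Rl d l z k)%:E * P (npoints_eq Phi (eball d (2 * l)) k))%E
    @[l --> +oo] --> cdf (distance_to_nucleus Y) z.
Proof.
case: d Phi Y => [|[|n]] Phi Y // _ lambda0 hPhi hY z0.
rewrite (cdf_distance_to_nucleus z hY); apply/cvge_pinftyP => u uoo.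
(* radii at least z, so that every ratio is bounded by 1 *)
pose v m := Num.max (u m) (z + 1).
have zv m : z + 1 <= v m by rewrite /v le_max lexx orbT.
have zv' m : z <= v m by rewrite (le_trans _ (zv m))// lerDl.
have voo : v m @[m --> \oo] --> +oo.
  apply/cvgryPge => A; near=> m; rewrite /v le_max; apply/orP; left.
  by near: m; have H := (cvgryPge u).1 uoo A; exact: H.
apply: cvg_trans (cvg_expectation_cell_ratio hPhi zv' voo); apply: near_eq_cvg.
near=> m; have zu : z + 1 <= u m.
  by near: m; have H := (cvgryPge u).1 uoo (z + 1); exact: H.
have -> : v m = u m by rewrite /v; apply/max_idPl.
rewrite (mixture_expectation lambda0 hPhi z0)//.
- by rewrite (lt_le_trans _ zu)// ltr_wpDl.
- by rewrite (le_trans _ zu)// lerDl.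
Unshelve. all: by end_near. Qed.
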